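(* Assume the standing assumptions in the context, $\sum_{t=0}^\infty(\eta^t)^2<\infty$, and $$0<\alpha\le\min\left\{\frac1{2\Gamma L},\ \frac{\psi}{L\Psi^2},\ \frac{\psi}{16\Gamma^2\mathcal C_{net}}\right\}.$$ Let $\{(\mathbf x^t,\mathbf v^t)\}$ be generated by AdaDQN (see context), let $q_i^t\in\{0,\dots,K_g-1\}$ be the number of nonmandatory local updates executed by node $i$ at iteration $t$, let $$\mathcal R^t:=\|\mathbf v^t\|^2+\|\mathbf v^t-\mathbf M\mathbf v^t\|^2+\|\mathbf x^t-\mathbf M\mathbf x^t\|^2,\qquad D_T:=P(\mathbf x^0,\mathbf v^0)-\underline F+\Theta_T,$$ and count one local gradient evaluation for every executed nonmandatory step and one mandatory gradient evaluation per node and outer iteration. Then for every integer $T\ge1$, $$\mathcal G_{\rm Ada}(T):=n+nT+\sum_{t=0}^{T-1}\sum_{i=1}^nq_i^t\le n+nT+\frac{C_{\rm loc}\alpha^2D_T}{C_f\tilde\varepsilon^2}.$$ In particular, letting $$D_\infty:=P(\mathbf x^0,\mathbf v^0)-\underline F+(\theta_1+\theta_2)\sum_{t=0}^\infty(\eta^t)^2,$$ for every $\delta>0$ AdaDQN returns an iterate with $\mathcal R^t\le\delta$ using a number of local gradient evaluations $$\mathcal G_{\rm Ada}(\delta)\le n+n\left\lceil\frac{D_\infty}{\widehat C\delta}\right\rceil+\frac{C_{\rm loc}\alpha^2D_\infty}{C_f\tilde\varepsilon^2}.$$ Since $C_f\ge\alpha\psi/(16n)$, this gives $\mathcal G_{\rm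 Ada}(\delta)=\mathcal O(n/\delta+n\alpha\tilde\varepsilon^{-2})$, with no dependence on the maximum local-update budget $K_g$.
   Context: Problem and standing assumptions. Let $f_1,\dots,f_n:\mathbb{R}^p\to\mathbb{R}$ be continuously differentiable (possibly nonconvex) and $F(\mathbf{z})=\frac1n\sum_{i=1}^n f_i(\mathbf{z})$. Assume: (i) $F$ is bounded below, $\underline F:=\inf_{\mathbf z}F(\mathbf z)>-\infty$; (ii) each $\nabla f_i$ is Lipschitz continuous with constant $L>0$; (iii) the communication graph $\mathcal{G}=(\{1,\dots,n\},\mathcal{E})$ is fixed, connected and undirected; $\mathcal{N}_i$ denotes the set of neighbors of $i$, including $i$ itself. Mixing matrix. $\tilde{\mathbf W}=[\tilde W_{ij}]\in\mathbb{R}^{n\times n}$ is symmetric, doubly stochastic, with $\tilde W_{ij}>0$ if $j\in\mathcal N_i$ and $\tilde W_{ij}=0$ otherwise. $\mathbf W=\tilde{\mathbf W}\otimes\mathbf I_p$, $\mathbf M=\frac1n\mathbf 1_n\mathbf 1_n^{\sf T}\otimes\mathbf I_p$, and $\sigma$ is the second largest eigenvalue magnitude of $\tilde{\mathbf W}$; it is assumed that $0<\sigma<1$. Notation. For $\mathbf u_1,\dots,\mathbf u_n\in\mathbb R^p$, $\mathbf u=[\mathbf u_1;\dots;\mathbf u_n]\in\mathbb R^{np}$ and $\bar{\mathbf u}=\frac1n\sum_i\mathbf u_i$. $\mathbf g_i^t=\nabla f_i(\mathbf x_i^t)$, $\mathbf g_i^{t,k}=\nabla f_i(\mathbf x_i^{t,k})$.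 $\|\cdot\|$ is the Euclidean norm. Superscripts on $\eta^t$ and $\tau^s$ are sequence indices. AdaDQN algorithm. Parameters: stepsize $\alpha>0$, integers $K_g,K_c\ge1$, $0<l\le u$, $\varrho>0$, $\varepsilon\gg\tilde\varepsilon>0$, $\gamma>0$, nonnegative non-increasing threshold sequences $\{\eta^t\}$, $\{\tau^s\}$. Initialize $\mathbf x_i^0$ arbitrarily, $\mathbf v_i^0=\mathbf g_i^0$, $\mathbf H_i^0=\mathbf I_p$. At iteration $t$, every node $i$ does: 1. $\mathbf x_i^{t,0}=\mathbf x_i^t$, $\mathbf v_i^{t,0}=\mathbf v_i^t$, $\mathbf H_i^{t,0}=\mathbf H_i^t$. 2. For $k=0,\dots,K_g-2$: if $\alpha\|\mathbf H_i^{t,k}\mathbf v_i^{t,k}\|<\max\{\varepsilon\|\mathbf x_i^t-\sum_{j\in\mathcal N_i}\tilde W_{ij}\mathbf x_j^t\|,\tilde\varepsilon\}$ or $\|\mathbf x_i^{t,k}-\mathbf x_i^t\|>\gamma\alpha\|\mathbf v_i^t\|$, then set $(\mathbf x_i^{t,k+1},\mathbf v_i^{t,k+1},\mathbf H_i^{t,k+1})=(\mathbf x_i^{t,k},\mathbf v_i^{t,k},\mathbf H_i^{t,k})$; otherwise (an executed nonmandatory local update) set $\mathbf x_i^{t,k+1}=\mathbf x_i^{t,k}-\alpha\mathbf H_i^{t,k}\mathbf v_i^{t,k}$, $\mathbf v_i^{t,k+1}=\mathbf v_i^{t,k}+\mathbf g_i^{t,k+1}-\mathbf g_i^{t,k}$,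 and $\mathbf H_i^{t,k+1}=\mathrm{MBFGS}(\mathbf s,\check{\mathbf y},\Delta\mathbf g)$ with $\mathbf s=\mathbf x_i^{t,k+1}-\mathbf x_i^{t,k}$, $\check{\mathbf y}=\Delta\mathbf g=\mathbf g_i^{t,k+1}-\mathbf g_i^{t,k}$. 3. Mandatory step: $\mathbf x_i^{t,K_g}=\mathbf x_i^{t,K_g-1}-\alpha\mathbf H_i^{t,K_g-1}\mathbf v_i^{t,K_g-1}$. 4. $\mathbf x_i^{t+1}=\mathrm{ETC}(\mathbf x^{t,K_g})_i$; then $\mathbf v_i^{t,K_g}=\mathbf v_i^{t,K_g-1}+\mathbf g_i^{t+1}-\mathbf g_i^{t,K_g-1}$; then $\mathbf v_i^{t+1}=\mathrm{ETC}(\mathbf v^{t,K_g})_i$. 5. $\mathbf H_i^{t+1}=\mathrm{MBFGS}(\mathbf x_i^{t+1}-\mathbf x_i^t,\ \mathbf v_i^{t+1}-\mathbf v_i^t,\ \mathbf g_i^{t+1}-\mathbf g_i^t)$. $\mathrm{ETC}$ (event-triggered communication at iteration $t$): given inputs $\mathbf u_i$, set $\mathbf u_i^0=\hat{\mathbf u}_i^0=\mathbf u_i$; for $s=0,\dots,K_c-1$ set $\mathbf u_i^{s+1}=\mathbf u_i^s-(\hat{\mathbf u}_i^s-\sum_{j\in\mathcal N_i}\tilde W_{ij}\hat{\mathbf u}_j^s)$, and $\hat{\mathbf u}_i^{s+1}=\mathbf u_i^{s+1}$ if $\|\mathbf u_i^{s+1}-\hat{\mathbf u}_i^s\|\ge\eta^t\tau^{s+1}$,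 $\hat{\mathbf u}_i^{s+1}=\hat{\mathbf u}_i^s$ otherwise. Output $\mathbf u_i^{K_c}$. $\mathrm{MBFGS}(\mathbf s,\check{\mathbf y},\Delta\mathbf g)$: if $\mathbf s=0$ return $\mathbf I_p$. Let $B(\mathbf s,\mathbf y)=\frac{\mathbf s^{\sf T}\mathbf y}{\|\mathbf y\|^2}\mathbf I_p-\frac{\mathbf s\mathbf y^{\sf T}+\mathbf y\mathbf s^{\sf T}}{\|\mathbf y\|^2}+2\frac{\mathbf s\mathbf s^{\sf T}}{\mathbf s^{\sf T}\mathbf y}$. If $\mathbf s^{\sf T}\check{\mathbf y}>0$ and all eigenvalues of $B(\mathbf s,\check{\mathbf y})$ lie in $[l,u]$, return $B(\mathbf s,\check{\mathbf y})$; otherwise return $B(\mathbf s,\Delta\mathbf g+h\mathbf s)$ with $h=\varrho+\max\{-\mathbf s^{\sf T}\Delta\mathbf g/\|\mathbf s\|^2,0\}$. Constants: $\psi=\min\{1,l,\frac{\varrho}{2(2L+\varrho)^2}\}$, $\Psi=\max\{1,u,\frac2\varrho\}$ (all matrices generated satisfy $\psi\mathbf I_p\preceq\mathbf H\preceq\Psi\mathbf I_p$), $\Gamma=\gamma+4\Psi$, $$\mathcal C_{net}=L+\frac{2L^2}{n(1-\sigma^{2K_c})}+\frac{288(1+\sigma^{2K_c})L^2}{n(1-\sigma^{2K_c})^3}+2n\sigma^{2K_c}\frac{1+\sigma^{2K_c}}{1-\sigma^{2K_c}}+\frac7{24}n\sigma^{2K_c}(1-\sigma^{2K_c}),$$ $$C_{\rm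 loc}=\frac{\Psi^2\left(\Gamma+\frac L2\Gamma^2\alpha\right)}{\psi-\frac L2\alpha\Psi^2},\qquad C_f=\frac\alpha n\left[\frac\psi4-\alpha\left(\frac{L\Psi^2}8+\Gamma^2\mathcal C_{net}\right)\right],$$ $$C_x=\frac{(1-\sigma^{2K_c})(3-2\sigma^{2K_c})}8,\quad C_v=\frac{(1-\sigma^{2K_c})^3}{1152(1+\sigma^{2K_c})L^2},\quad \widehat C=\min\{C_f,C_x,C_v\},$$ $$\theta_1=8\,\frac{1+\sigma^{2K_c}}{1-\sigma^{2K_c}}\,n\Big(\sum_{k=0}^{K_c-1}\sigma^k\tau^{K_c-1-k}\Big)^2,\quad \theta_2=\frac{(1-\sigma^{2K_c})(1+3\sigma^{2K_c}L^2)}{24L^2}\,n\Big(\sum_{k=0}^{K_c-1}\sigma^k\tau^{K_c-1-k}\Big)^2,$$ and $\Theta_T=(\theta_1+\theta_2)\sum_{t=0}^{T-1}(\eta^t)^2$. Potential function: $$P(\mathbf x^t,\mathbf v^t)=F(\bar{\mathbf x}^t)+\|\mathbf x^t-\mathbf M\mathbf x^t\|^2+\frac{(1-\sigma^{2K_c})^2}{288(1+\sigma^{2K_c})L^2}\|\mathbf v^t-\mathbf M\mathbf v^t\|^2 .$$ The constants hidden in $\mathcal O$ involve only $D_\infty,\widehat C,C_{\rm loc},\psi$ (none of which depends on $K_g$). *)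

(* Defs.v *)
From HB Require Import structures.
From mathcomp Require Import all_boot all_order all_algebra.
From mathcomp.real_closed Require Import mxtens.
From mathcomp Require Import all_classical all_reals all_analysis.
Set Implicit Arguments.
Unset Strict Implicit.
Unset Printing Implicit Defensive.
Import Order.TTheory GRing.Theory Num.Theory.
Import numFieldNormedType.Exports.
Local Open Scope classical_set_scope.
Local Open Scope ring_scope.

Section Euclidean.
Context {R : realType}.

Definition dot m (u v : 'cV[R]_m) : R := (u^T *m v) 0 0.

(* The library norm [`|u|] on matrices is the sup norm, hence this one. *)
Definition enorm m (u : 'cV[R]_m) : R := Num.sqrt (dot u u).

Definition gradient m (f : 'cV[R]_m -> R) (x : 'cV[R]_m) : 'cV[R]_m :=
  \col_i 'D_(delta_mx i 0) f x.

Definition C1 m (f : 'cV[R]_m -> R) : Prop :=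
  (forall x, differentiable f x) /\ continuous (gradient f).

(* [s] is the second entry of the list of eigenvalue magnitudes, counted with
   multiplicity and sorted in decreasing order (0 if there is no second one). *)
Definition second_eigenvalue_magnitude n (A : 'M[R]_n) (s : R) : Prop :=
  exists2 e : seq R, char_poly A = \prod_(a <- e) ('X - a%:P)
    & s = (sort (fun a b => b <= a) [seq `|a| | a <- e])`_1.

Definition stack n p (u : 'I_n -> 'cV[R]_p) : 'cV[R]_(n * p) :=
  \col_k u (mxtens_unindex k).1 (mxtens_unindex k).2 0.

Definition mean n p (u : 'I_n -> 'cV[R]_p) : 'cV[R]_p := n%:R^-1 *: \sum_i u i.

Definition Mmx n p : 'M[R]_(n * p) :=
  (n%:R^-1 *: ((const_mx 1 : 'cV[R]_n) *m (const_mx 1 : 'cV[R]_n)^T))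
    *t (1%:M : 'M[R]_p).

End Euclidean.

(* Problem data together with the parameters and the starting point of the
   algorithm; the constraints on them are in [standing_assumptions]. *)
Record setup (R : realType) (n p : nat) := Setup {
  fobj : 'I_n -> 'cV[R]_p -> R;
  Lip : R;
  edge : rel 'I_n;
  Wt : 'M[R]_n;
  sigma : R;
  alpha : R;
  Kg : nat;
  Kc : nat;
  lbd : R;
  ubd : R;
  varrho : R;
  eps : R;
  epst : R;
  gam : R;
  eta_seq : R^nat;
  tau_seq : R^nat;
  x0 : 'I_n -> 'cV[R]_p }.

Record state (R : realType) (n p : nat) := State {
  st_x : 'I_n -> 'cV[R]_p;
  st_v : 'I_n -> 'cV[R]_p;
  st_H : 'I_n -> 'M[R]_p }.

Record lstate (R : realType) (p : nat) := LState {
  lx : 'cV[R]_p;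
  lv : 'cV[R]_p;
  lH : 'M[R]_p }.

Section AdaDQN.
Context {R : realType} {n p : nat} (D : setup R n p).
Implicit Types (i j : 'I_n) (S : state R n p) (w : lstate R p).

Local Notation vec := 'cV[R]_p.
Local Notation grad i := (gradient (fobj D i)).

Definition F (z : vec) : R := n%:R^-1 * \sum_i fobj D i z.
Definition Finf : R := inf (range F).

(* Closed neighbourhood: a node is its own neighbour. *)
Definition nbhd i : {set 'I_n} := [set j | (j == i) || edge D i j].

Definition mix (u : 'I_n -> vec) i : vec := \sum_(j in nbhd i) Wt D i j *: u j.

Record standing_assumptions : Prop := {
  fobj_C1 : forall i, C1 (fobj D i);
  F_bounded_below : has_lbound (range F);
  Lip_gt0 : 0 < Lip D;
  grad_lipschitz : forall i x y,
    enorm (grad i x - grad i y) <= Lip D * enorm (x - y);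
  edge_sym : symmetric (edge D);
  edge_connected : forall i j, connect (edge D) i j;
  Wt_sym : (Wt D)^T = Wt D;
  Wt_row_sum : forall i, \sum_j Wt D i j = 1;
  Wt_col_sum : forall j, \sum_i Wt D i j = 1;
  Wt_gt0 : forall i j, j \in nbhd i -> 0 < Wt D i j;
  Wt_eq0 : forall i j, j \notin nbhd i -> Wt D i j = 0;
  sigma_def : second_eigenvalue_magnitude (Wt D) (sigma D);
  sigma_gt0 : 0 < sigma D;
  sigma_lt1 : sigma D < 1;
  alpha_gt0 : 0 < alpha D;
  Kg_ge1 : (1 <= Kg D)%N;
  Kc_ge1 : (1 <= Kc D)%N;
  lbd_gt0 : 0 < lbd D;
  lbd_le_ubd : lbd D <= ubd D;
  varrho_gt0 : 0 < varrho D;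
  epst_gt0 : 0 < epst D;
  (* the only definite content of "eps much larger than epst" *)
  epst_lt_eps : epst D < eps D;
  gam_gt0 : 0 < gam D;
  eta_ge0 : forall t, 0 <= eta_seq D t;
  eta_noninc : nonincreasing_seq (eta_seq D);
  tau_ge0 : forall s, 0 <= tau_seq D s;
  tau_noninc : nonincreasing_seq (tau_seq D) }.

Definition Bmx (s y : vec) : 'M[R]_p :=
  (dot s y / enorm y ^+ 2)%:M
  - (enorm y ^+ 2)^-1 *: (s *m y^T + y *m s^T)
  + (2 / dot s y) *: (s *m s^T).

(* [Bmx s y] is symmetric, so its real eigenvalues are all its eigenvalues. *)
Definition MBFGS (s yc dg : vec) : 'M[R]_p :=
  if s == 0 then 1%:M else
  if (0 < dot s yc) &&
     `[< forall a, eigenvalue (Bmx s yc) a -> lbd D <= a <= ubd D >]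
  then Bmx s yc
  else let h := varrho D + Num.max (- dot s dg / enorm s ^+ 2) 0 in
       Bmx s (dg + h *: s).

(* The pair of u^s and its last broadcast copy \hat u^s, at outer iteration t. *)
Fixpoint etc_iter (t : nat) (u : 'I_n -> vec) (s : nat) :
    ('I_n -> vec) * ('I_n -> vec) :=
  if s is s'.+1 then
    let: (us, uh) := etc_iter t u s' in
    let us1 := fun i => us i - (uh i - mix uh i) in
    (us1, fun i => if eta_seq D t * tau_seq D s <= enorm (us1 i - uh i)
                   then us1 i else uh i)
  else (u, u).

Definition ETC (t : nat) (u : 'I_n -> vec) : 'I_n -> vec :=
  (etc_iter t u (Kc D)).1.

Definition local_skip S i w : bool :=
  (alpha D * enorm (lH w *m lv w)
     < Num.max (eps D * enorm (st_x S i - mix (st_x S) i)) (epst D))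
  || (gam D * alpha D * enorm (st_v S i) < enorm (lx w - st_x S i)).

Definition local_step S i w : lstate R p :=
  if local_skip S i w then w else
  let x' := lx w - alpha D *: (lH w *m lv w) in
  let dg := grad i x' - grad i (lx w) in
  LState x' (lv w + dg) (MBFGS (x' - lx w) dg dg).

(* (x_i^{t,k}, v_i^{t,k}, H_i^{t,k}) for k <= Kg - 1, S being the state at t. *)
Definition local_iter S i (k : nat) : lstate R p :=
  iter k (local_step S i) (LState (st_x S i) (st_v S i) (st_H S i)).

Definition outer_step (t : nat) S : state R n p :=
  let w := fun i => local_iter S i (Kg D).-1 in
  let x' := ETC t (fun i => lx (w i) - alpha D *: (lH (w i) *m lv (w i))) in
  let v' := ETC t (fun i => lv (w i) + grad i (x' i) - grad i (lx (w i))) in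
  State x' v' (fun i => MBFGS (x' i - st_x S i) (v' i - st_v S i)
                              (grad i (x' i) - grad i (st_x S i))).

Fixpoint adadqn (t : nat) : state R n p :=
  if t is t'.+1 then outer_step t' (adadqn t')
  else State (x0 D) (fun i => grad i (x0 D i)) (fun=> 1%:M).

Definition xit (t : nat) : 'I_n -> vec := st_x (adadqn t).
Definition vit (t : nat) : 'I_n -> vec := st_v (adadqn t).

(* Number of executed nonmandatory local updates of node i at iteration t. *)
Definition nlocal (t : nat) i : nat :=
  \sum_(k < (Kg D).-1)
     ~~ local_skip (adadqn t) i (local_iter (adadqn t) i k).

(* Local gradient evaluations used to produce x^T and v^T. *)
Definition Gada (T : nat) : nat :=
  (n + n * T + \sum_(t < T) \sum_(i < n) nlocal t i)%N.

Local Notation s2 := (sigma D ^+ (2 * Kc D)).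
Local Notation L := (Lip D).
Local Notation N := (n%:R : R).

Definition psi : R :=
  Num.min (Num.min 1 (lbd D)) (varrho D / (2 * (2 * L + varrho D) ^+ 2)).
Definition Psi : R := Num.max (Num.max 1 (ubd D)) (2 / varrho D).
Definition Gamma : R := gam D + 4 * Psi.

Definition Cnet : R :=
  L + 2 * L ^+ 2 / (N * (1 - s2))
  + 288 * (1 + s2) * L ^+ 2 / (N * (1 - s2) ^+ 3)
  + 2 * N * s2 * ((1 + s2) / (1 - s2))
  + 7 / 24 * N * s2 * (1 - s2).

Definition Cloc : R :=
  Psi ^+ 2 * (Gamma + L / 2 * Gamma ^+ 2 * alpha D)
  / (psi - L / 2 * alpha D * Psi ^+ 2).

Definition Cf : R :=
  alpha D / N * (psi / 4 - alpha D * (L * Psi ^+ 2 / 8 + Gamma ^+ 2 * Cnet)).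
Definition Cx : R := (1 - s2) * (3 - 2 * s2) / 8.
Definition Cv : R := (1 - s2) ^+ 3 / (1152 * (1 + s2) * L ^+ 2).
Definition Chat : R := Num.min (Num.min Cf Cx) Cv.

Definition etc_sum : R :=
  \sum_(k < Kc D) sigma D ^+ k * tau_seq D (Kc D - 1 - k)%N.
Definition theta1 : R := 8 * ((1 + s2) / (1 - s2)) * N * etc_sum ^+ 2.
Definition theta2 : R :=
  (1 - s2) * (1 + 3 * s2 * L ^+ 2) / (24 * L ^+ 2) * N * etc_sum ^+ 2.

Definition Theta (T : nat) : R :=
  (theta1 + theta2) * \sum_(t < T) eta_seq D t ^+ 2.

(* || u - M u || *)
Definition consensus_err (u : 'I_n -> vec) : R :=
  enorm (stack u - Mmx n p *m stack u).

Definition potential (x v : 'I_n -> vec) : R :=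
  F (mean x) + consensus_err x ^+ 2
  + (1 - s2) ^+ 2 / (288 * (1 + s2) * L ^+ 2) * consensus_err v ^+ 2.

Definition DT (T : nat) : R :=
  potential (xit 0) (vit 0) - Finf + Theta T.
Definition Dinf : R :=
  potential (xit 0) (vit 0) - Finf
  + (theta1 + theta2) * limn (series (fun t => eta_seq D t ^+ 2)).

Definition residual (t : nat) : R :=
  enorm (stack (vit t)) ^+ 2 + consensus_err (vit t) ^+ 2
  + consensus_err (xit t) ^+ 2.

(* x^t is the first iterate of accuracy delta, so that [Gada t] is the number
   G_Ada(delta) of gradient evaluations spent to reach this accuracy. *)
Definition first_hit (delta : R) (t : nat) : Prop :=
  residual t <= delta /\ forall s, (s < t)%N -> delta < residual s.

End AdaDQN.

(* Main.v *)
(* A node's local updates are descent steps on its objective tilted by the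
   tracking error v_i - grad f_i, whose gradient along the local iterates is
   exactly v_i^{t,k}.  Hence the squared norms of the directions of the executed
   steps add up to at most C_loc |v_i|^2; as each executed step has length at
   least epst, this bounds the number of executed steps, independently of K_g.

   Summing over t requires a bound on sum_t |v^t|^2, which comes from the descent
   of the potential P.  Gradient tracking keeps the mean of v equal to the mean of
   the local gradients, so F(mean x) decreases up to consensus errors; these are
   contracted by sigma^{K_c} in a communication round, up to the triggering error.
   The contraction is the spectral bound |W - 11^T/n| <= sigma: an eigenvector of
   W - 11^T/n for a nonzero eigenvalue is orthogonal to 1, thus an eigenvector of
   W, and by connectivity it is not one for the eigenvalue 1. *)

Require Import Defs.
From HB Require Import structures.
From mathcomp Require Import all_boot all_order all_algebra.
From mathcomp Require Import all_classical all_reals all_analysis.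
From mathcomp Require Import ring lra.
From mathcomp.real_closed Require Import mxtens.
Set Implicit Arguments.
Unset Strict Implicit.
Unset Printing Implicit Defensive.
Import Order.TTheory GRing.Theory Num.Theory.
Import numFieldNormedType.Exports.
Local Open Scope classical_set_scope.
Local Open Scope ring_scope.

(** * Euclidean space and symmetric matrices *)

Section Euclid.
Context {R : realType}.

Lemma dotE m (u v : 'cV[R]_m) : dot u v = \sum_i u i 0 * v i 0.
Proof. by rewrite /dot mxE; apply: eq_bigr => i _; rewrite mxE. Qed.

Lemma dotC m (u v : 'cV[R]_m) : dot u v = dot v u.
Proof. by rewrite !dotE; apply: eq_bigr => i _; rewrite mulrC. Qed.

Lemma dotDl m (u v w : 'cV[R]_m) : dot (u + v) w = dot u w + dot v w.
Proof. by rewrite /dot linearD mulmxDl mxE. Qed.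

Lemma dotDr m (u v w : 'cV[R]_m) : dot w (u + v) = dot w u + dot w v.
Proof. by rewrite /dot mulmxDr mxE. Qed.

Lemma dotNl m (u w : 'cV[R]_m) : dot (- u) w = - dot u w.
Proof. by rewrite /dot linearN mulNmx mxE. Qed.

Lemma dotNr m (u w : 'cV[R]_m) : dot w (- u) = - dot w u.
Proof. by rewrite /dot mulmxN mxE. Qed.

Lemma dotBl m (u v w : 'cV[R]_m) : dot (u - v) w = dot u w - dot v w.
Proof. by rewrite dotDl dotNl. Qed.

Lemma dotBr m (u v w : 'cV[R]_m) : dot w (u - v) = dot w u - dot w v.
Proof. by rewrite dotDr dotNr. Qed.

Lemma dotZl m a (u w : 'cV[R]_m) : dot (a *: u) w = a * dot u w.
Proof. by rewrite /dot linearZ -scalemxAl mxE. Qed.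

Lemma dotZr m a (u w : 'cV[R]_m) : dot w (a *: u) = a * dot w u.
Proof. by rewrite /dot -scalemxAr mxE. Qed.

Lemma dot0l m (w : 'cV[R]_m) : dot 0 w = 0.
Proof. by rewrite /dot trmx0 mul0mx mxE. Qed.

Lemma dot0r m (w : 'cV[R]_m) : dot w 0 = 0.
Proof. by rewrite dotC dot0l. Qed.

Lemma dot_suml m (I : finType) (u : I -> 'cV[R]_m) w :
  dot (\sum_i u i) w = \sum_i dot (u i) w.
Proof.
by elim/big_rec2: _ => [|i y x _ <-]; rewrite ?dot0l ?dotDl.
Qed.

Lemma dot_sumr m (I : finType) (u : I -> 'cV[R]_m) w :
  dot w (\sum_i u i) = \sum_i dot w (u i).
Proof. by rewrite dotC dot_suml; apply: eq_bigr => i _; rewrite dotC. Qed.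

Lemma dot_ge0 m (u : 'cV[R]_m) : 0 <= dot u u.
Proof. by rewrite dotE sumr_ge0 // => i _; rewrite -expr2 sqr_ge0. Qed.

Lemma dot_eq0 m (u : 'cV[R]_m) : (dot u u == 0) = (u == 0).
Proof.
apply/idP/eqP => [|->]; last by rewrite dot0l.
rewrite dotE psumr_eq0 => [/allP h|i _]; last by rewrite -expr2 sqr_ge0.
apply/colP => i; rewrite mxE; apply/eqP.
by have /= := h i (mem_index_enum i); rewrite mulf_eq0 orbb.
Qed.

Lemma dot_gt0 m (u : 'cV[R]_m) : u != 0 -> 0 < dot u u.
Proof. by rewrite lt_def dot_eq0 dot_ge0 andbT. Qed.

Lemma dot_mulmxr m k (A : 'M[R]_(m, k)) u v : dot u (A *m v) = dot (A^T *m u) v.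
Proof. by rewrite /dot trmx_mul trmxK mulmxA. Qed.

Lemma dot_sym m (A : 'M[R]_m) u v : A^T = A -> dot u (A *m v) = dot v (A *m u).
Proof. by move=> sA; rewrite dot_mulmxr sA dotC. Qed.

Lemma enorm_ge0 m (u : 'cV[R]_m) : 0 <= enorm u.
Proof. exact: sqrtr_ge0. Qed.

Lemma sqr_enorm m (u : 'cV[R]_m) : enorm u ^+ 2 = dot u u.
Proof. by rewrite sqr_sqrtr ?dot_ge0. Qed.

Lemma ler_of_sqr (x y : R) : 0 <= y -> x ^+ 2 <= y ^+ 2 -> x <= y.
Proof.
move=> y0; case: (lerP 0 x) => [x0|x0 _]; last exact: le_trans (ltW x0) y0.
by rewrite ler_pXn2r.
Qed.

(* Nonnegativity of the form at [c u - b v] and at [b u - a v]. *)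
Lemma psd_cauchy m (A : 'M[R]_m) (u v : 'cV[R]_m) :
  A^T = A -> (forall w, 0 <= dot w (A *m w)) ->
  dot u (A *m v) ^+ 2 <= dot u (A *m u) * dot v (A *m v).
Proof.
move=> sA pA; set a := dot u (A *m u); set c := dot v (A *m v).
set b := dot u (A *m v).
have E (x y : R) : dot (x *: u - y *: v) (A *m (x *: u - y *: v)) =
   x ^+ 2 * a - 2 * x * y * b + y ^+ 2 * c.
  rewrite mulmxBr -!scalemxAr dotBl !dotBr !dotZl !dotZr.
  by rewrite (dot_sym v u sA) -/a -/b -/c; ring.
have a0 : 0 <= a by exact: pA.
have c0 : 0 <= c by exact: pA.
have h1 := pA (c *: u - b *: v); rewrite E in h1.
have h2 := pA (b *: u - a *: v); rewrite E in h2.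
(* The third test vector is for the case a = c = 0, where it gives -2 b^2 >= 0. *)
have h3 := pA (1 *: u - b *: v); rewrite E in h3.
move: c0; rewrite le_eqVlt => /orP[/eqP c0|c0].
  move: a0; rewrite le_eqVlt => /orP[/eqP a0|a0].
    by move: h3; rewrite -a0 -c0; nra.
  have : 0 <= a * (a * c - b ^+ 2) by nra.
  by rewrite pmulr_rge0 // subr_ge0.
have : 0 <= c * (a * c - b ^+ 2) by nra.
by rewrite pmulr_rge0 // subr_ge0.
Qed.

Lemma cauchy_schwarz m (u v : 'cV[R]_m) : dot u v ^+ 2 <= dot u u * dot v v.
Proof.
have := @psd_cauchy m 1%:M u v; rewrite !mul1mx trmx1; apply => // w.
by rewrite mul1mx dot_ge0.
Qed.

Lemma dot_le_enorm m (u v : 'cV[R]_m) : dot u v <= enorm u * enorm v.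
Proof.
apply: ler_of_sqr; first by rewrite mulr_ge0 ?enorm_ge0.
by rewrite exprMn !sqr_enorm cauchy_schwarz.
Qed.

Lemma dot_ge_enorm m (u v : 'cV[R]_m) : - (enorm u * enorm v) <= dot u v.
Proof.
rewrite lerNl -dotNl (le_trans (dot_le_enorm _ _)) //.
by rewrite /enorm dotNl dotNr opprK.
Qed.

Lemma enormN m (u : 'cV[R]_m) : enorm (- u) = enorm u.
Proof. by rewrite /enorm dotNl dotNr opprK. Qed.

Lemma enorm0 m : enorm (0 : 'cV[R]_m) = 0.
Proof. by rewrite /enorm dot0l sqrtr0. Qed.

Lemma enorm_eq0 m (u : 'cV[R]_m) : (enorm u == 0) = (u == 0).
Proof. by rewrite -sqrf_eq0 sqr_enorm dot_eq0. Qed.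

Lemma enormZ m (a : R) (u : 'cV[R]_m) : 0 <= a -> enorm (a *: u) = a * enorm u.
Proof.
move=> a0; rewrite /enorm dotZl dotZr mulrA -expr2 sqrtrM ?sqr_ge0 //.
by rewrite sqrtr_sqr ger0_norm.
Qed.

Lemma enormD m (u v : 'cV[R]_m) : enorm (u + v) <= enorm u + enorm v.
Proof.
apply: ler_of_sqr; first by rewrite addr_ge0 ?enorm_ge0.
rewrite sqr_enorm dotDl !dotDr (dotC v u) sqrrD !sqr_enorm.
by have := dot_le_enorm u v; lra.
Qed.

Lemma enormB m (u v : 'cV[R]_m) : enorm (u - v) <= enorm u + enorm v.
Proof. by rewrite (le_trans (enormD _ _)) // enormN. Qed.

Lemma enorm_distC m (u v : 'cV[R]_m) : enorm (u - v) = enorm (v - u).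
Proof. by rewrite -enormN opprB. Qed.

Lemma enorm_leP m (u : 'cV[R]_m) (a : R) :
  0 <= a -> enorm u <= a <-> dot u u <= a ^+ 2.
Proof.
move=> a0; rewrite -sqr_enorm; split=> [h|]; last exact: ler_of_sqr.
by rewrite lerXn2r ?nnegrE ?enorm_ge0.
Qed.

(** Cauchy-Schwarz on each row yields the squared Frobenius norm; the added 1 makes the constant
    positive, so that it can serve as a divisor. *)
Lemma dot_mulmx_bound m k (A : 'M[R]_(m, k)) :
  exists2 C : R, 0 < C & forall w, dot (A *m w) (A *m w) <= C * dot w w.
Proof.
pose r i : 'cV[R]_k := (row i A)^T.
exists (1 + \sum_i dot (r i) (r i)).
  by rewrite ltr_pwDl // sumr_ge0 // => i _; exact: dot_ge0.
move=> w; rewrite mulrDl mul1r mulr_suml dotE.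
apply: (@le_trans _ _ (\sum_i dot (r i) (r i) * dot w w)); last first.
  by rewrite lerDr dot_ge0.
apply: ler_sum => i _; rewrite -expr2.
have -> : (A *m w) i 0 = dot (r i) w.
  by rewrite dotE mxE; apply: eq_bigr => j _; rewrite !mxE.
exact: cauchy_schwarz.
Qed.

(** * Spectral bounds for symmetric matrices *)

Lemma eigenvalue_nonunit m (A : 'M[R]_m) a :
  eigenvalue A a = (A - a%:M \notin unitmx).
Proof. by rewrite /eigenvalue /eigenspace kermx_eq0 row_free_unit. Qed.

Lemma eigenvalue_vector m (A : 'M[R]_m) a : A^T = A -> eigenvalue A a ->
  exists2 w : 'cV[R]_m, w != 0 & A *m w = a *: w.
Proof.
move=> sA /eigenvalueP[v vA v0]; exists v^T; first by rewrite trmx_eq0.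
by rewrite -{1}sA -trmx_mul vA linearZ.
Qed.

(* The supremum [l] of the Rayleigh quotient is an eigenvalue: were
   [l - A >= 0] invertible, it would be bounded below by a positive multiple
   of the identity, and [l] could be decreased. *)
Lemma rayleigh_le m (A : 'M[R]_m) (u : R) : A^T = A ->
  (forall a, eigenvalue A a -> a <= u) ->
  forall w, dot w (A *m w) <= u * dot w w.
Proof.
move=> sA eA w0; rewrite leNgt; apply/negP => w0u.
pose S : set R :=
  [set r | exists w : 'cV[R]_m, w != 0 /\ r = dot w (A *m w) / dot w w].
have w0_neq0 : w0 != 0.
  by apply/eqP => w00; move: w0u; rewrite w00 mulmx0 !dot0l mulr0 ltxx.
have [C C0 AC] := dot_mulmx_bound A.
have supS : has_sup S.
  split; first by exists (dot w0 (A *m w0) / dot w0 w0), w0.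
  exists (1 + C) => _ [w [w_neq0 ->]]; rewrite ler_pdivrMr ?dot_gt0 //.
  have := dot_ge0 (w - A *m w); rewrite dotBl !dotBr (dotC (A *m w) w).
  have := AC w; have := dot_ge0 w; nra.
set l := sup S.
have lE w : dot w (A *m w) <= l * dot w w.
  have [->|w_neq0] := eqVneq w 0; first by rewrite dot0l dot0r mulr0.
  rewrite -ler_pdivrMr ?dot_gt0 //; apply: sup_upper_bound => //.
  by exists w.
have l_gt : u < l.
  rewrite (@lt_le_trans _ _ (dot w0 (A *m w0) / dot w0 w0)) //.
    by rewrite ltr_pdivlMr ?dot_gt0.
  by apply: sup_upper_bound => //; exists w0.
have : ~~ eigenvalue A l by apply/negP => /eA; rewrite leNgt l_gt.
rewrite eigenvalue_nonunit negbK => uAl.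
set B := l%:M - A.
have uB : B \in unitmx by rewrite /B -opprB -scaleN1r unitmxZ ?unitrN1.
have sB : B^T = B by rewrite /B linearB /= tr_scalar_mx sA.
have pB w : 0 <= dot w (B *m w).
  by rewrite mulmxBl mul_scalar_mx dotBr dotZr subr_ge0.
have [C1 C10 BC] := dot_mulmx_bound B.
have [C2 C20 IC] := dot_mulmx_bound (invmx B).
(* |w|^2 <= C2 |y|^2 by invertibility, and Cauchy-Schwarz for the form of [B] gives |y|^4 <= (y, B
   y)(w, y) <= (1 + C1) |y|^2 (w, y). *)
have pos w : dot w w <= C2 * (1 + C1) * dot w (B *m w).
  set y := B *m w.
  have hw : dot w w <= C2 * dot y y by have := IC y; rewrite mulKmx.
  have hy : dot y y <= (1 + C1) * dot w y.
    have h1 : dot y (B *m y) <= (1 + C1) * dot y y.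
      have := dot_ge0 (y - B *m y); rewrite dotBl !dotBr (dotC (B *m y) y).
      have := BC y; have := dot_ge0 y; nra.
    have h2 := psd_cauchy y w sB pB.
    have wy0 : 0 <= dot w y by exact: pB.
    rewrite -/y in h2.
    have := dot_ge0 y; rewrite le_eqVlt => /orP[/eqP <-|y0].
      by rewrite mulr_ge0 // addr_ge0 // ltW.
    rewrite -(ler_pM2l y0) -expr2 (le_trans h2) //.
    by rewrite mulrA [dot y y * _]mulrC ler_wpM2r.
  by rewrite (le_trans hw) // -mulrA ler_wpM2l // ltW.
have K0 : 0 < C2 * (1 + C1) by rewrite mulr_gt0 // addr_gt0.
(* A vector whose quotient is within 1 / (C2 (1 + C1)) of the supremum contradicts [pos]. *)
have [_ [w [w_neq0 ->]]] := sup_adherent (divr_gt0 ltr01 K0) supS.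
rewrite -/l ltr_pdivlMr ?dot_gt0 // => h.
have := pos w; rewrite mulmxBl mul_scalar_mx dotBr dotZr.
rewrite -ler_pdivrMl // => h'; move: h; rewrite mulrBl mul1r; lra.
Qed.

Lemma rayleigh_ge m (A : 'M[R]_m) (l : R) : A^T = A ->
  (forall a, eigenvalue A a -> l <= a) ->
  forall w, l * dot w w <= dot w (A *m w).
Proof.
move=> sA eA w; have := @rayleigh_le m (- A) (- l) _ _ w.
rewrite mulNmx dotNr mulNr lerN2; apply; first by rewrite linearN /= sA.
move=> a; rewrite eigenvalue_nonunit => h; rewrite lerNr; apply: eA.
rewrite eigenvalue_nonunit; apply: contra h => h.
rewrite -[_ - _]opprK opprB addrC -scaleN1r unitmxZ ?unitrN1 //.
by rewrite opprK; move: h; rewrite raddfN opprK.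
Qed.

(** Cauchy-Schwarz for the form of A at y = A w and w gives |y|^4 <= c |y|^2 (w, y), and (w, y) <= c
    |w|^2. *)
Lemma psd_enorm_le m (A : 'M[R]_m) (c : R) w : A^T = A -> 0 <= c ->
  (forall w, 0 <= dot w (A *m w) <= c * dot w w) ->
  enorm (A *m w) <= c * enorm w.
Proof.
move=> sA c0 hA; set y := A *m w.
rewrite enorm_leP ?mulr_ge0 ?enorm_ge0 // exprMn sqr_enorm.
have h1 : dot y y ^+ 2 <= dot w y * (c * dot y y).
  have pA z : 0 <= dot z (A *m z) by case/andP: (hA z).
  have h := psd_cauchy y w sA pA; rewrite -/y in h.
  apply: (le_trans h); rewrite mulrC; apply: ler_wpM2l; first exact: pA.
  by case/andP: (hA y).
have := dot_ge0 y; rewrite le_eqVlt => /orP[/eqP <-|y0].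
  by rewrite mulr_ge0 ?sqr_ge0 ?dot_ge0.
have h2 : dot y y <= c * dot w y by rewrite -(ler_pM2l y0); lra.
apply: (le_trans h2); rewrite expr2 -mulrA; apply: ler_wpM2l => //.
by case/andP: (hA w).
Qed.

(* Polarization: [4 (A w, A w')] is a difference of two values of the form. *)
Lemma sym_enorm_le m (A : 'M[R]_m) (s : R) w : A^T = A -> 0 <= s ->
  (forall a, eigenvalue A a -> `|a| <= s) ->
  enorm (A *m w) <= s * enorm w.
Proof.
move=> sA s0 eA; set y := A *m w.
have up v : dot v (A *m v) <= s * dot v v.
  by apply: rayleigh_le => // a /eA; rewrite ler_norml => /andP[].
have lo v : - s * dot v v <= dot v (A *m v).
  by apply: rayleigh_ge => // a /eA; rewrite ler_norml => /andP[].
have [y0|y_neq0] := eqVneq y 0; first by rewrite y0 enorm0 mulr_ge0 ?enorm_ge0.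
have ny : 0 < enorm y by rewrite lt_def enorm_ge0 enorm_eq0 y_neq0.
(* The weights give both vectors the same length, which makes the bound from polarization sharp
   enough. *)
have h1 := up (enorm y *: w + enorm w *: y).
have h2 := lo (enorm y *: w - enorm w *: y).
move: h1 h2; rewrite mulmxDr mulmxBr -!scalemxAr -/y.
rewrite !(dotDl, dotNl, dotDr, dotNr, dotZl, dotZr, opprK).
rewrite (dot_mulmxr A w y) sA -/y (dotC w y).
rewrite -!(sqr_enorm y) -!(sqr_enorm w) => h1 h2.
have : enorm w * enorm y ^+ 2 * enorm y
       <= enorm w * enorm y ^+ 2 * (s * enorm w) by nra.
have [w0|nw] := eqVneq w 0; first by move: y_neq0; rewrite /y w0 mulmx0 eqxx.
by rewrite ler_pM2l // mulr_gt0 ?exprn_gt0 // lt_def enorm_ge0 enorm_eq0 nw.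
Qed.

End Euclid.

(** * Stacked vectors, consensus error and smooth functions *)

Section Stacking.
Context {R : realType} {n p : nat}.
Implicit Types (u v : 'I_n -> 'cV[R]_p).

Lemma dot_stack u v : dot (stack u) (stack v) = \sum_i dot (u i) (v i).
Proof.
rewrite dotE (reindex (@mxtens_index n p)) /=; last first.
  by exists (@mxtens_unindex n p) => ij _; rewrite (mxtens_indexK, mxtens_unindexK).
under [RHS]eq_bigr do rewrite dotE.
rewrite pair_bigA /=; apply: eq_bigr => -[i c] _.
by rewrite !mxE mxtens_indexK.
Qed.

Lemma stackD u v : stack (fun i => u i + v i) = stack u + stack v.
Proof. by apply/colP => k; rewrite !mxE. Qed.

Lemma stackB u v : stack (fun i => u i - v i) = stack u - stack v.
Proof. by apply/colP => k; rewrite !mxE. Qed.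

Lemma enorm_stack_le u v : (forall i, enorm (u i) <= enorm (v i)) ->
  enorm (stack u) <= enorm (stack v).
Proof.
move=> uv; apply/enorm_leP; first exact: enorm_ge0.
rewrite sqr_enorm !dot_stack; apply: ler_sum => i _.
by rewrite -!sqr_enorm lerXn2r ?nnegrE ?enorm_ge0.
Qed.

Lemma enorm_stack_scale (a : R) u v : 0 <= a ->
  (forall i, enorm (u i) <= a * enorm (v i)) ->
  enorm (stack u) <= a * enorm (stack v).
Proof.
move=> a0 uv; rewrite -enormZ //.
have -> : a *: stack v = stack (fun i => a *: v i).
  by apply/colP => k; rewrite !mxE.
by apply: enorm_stack_le => i; rewrite enormZ.
Qed.

Lemma enorm_stack_bound (a : R) u : 0 <= a ->
  (forall i, enorm (u i) <= a) -> enorm (stack u) <= Num.sqrt n%:R * a.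
Proof.
move=> a0 ua; apply/enorm_leP; first by rewrite mulr_ge0 ?sqrtr_ge0.
rewrite dot_stack exprMn sqr_sqrtr //.
apply: (@le_trans _ _ (\sum_(i < n) a ^+ 2)); last first.
  by rewrite sumr_const card_ord mulr_natl.
by apply: ler_sum => i _; apply/enorm_leP.
Qed.

Lemma meanD u v : mean (fun i => u i + v i) = mean u + mean v.
Proof. by rewrite /mean big_split scalerDr. Qed.

Lemma meanB u v : mean (fun i => u i - v i) = mean u - mean v.
Proof. by rewrite /mean sumrB scalerBr. Qed.

Lemma sum_mean u : (0 < n)%N -> \sum_i u i = n%:R *: mean u.
Proof. by move=> n0; rewrite scalerA mulfV ?scale1r // pnatr_eq0 -lt0n. Qed.

Lemma Mmx_stack u : Mmx n p *m stack u = stack (fun=> mean u).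
Proof.
apply/colP => k; have [i c] := mxtens_indexP k.
rewrite mxE (reindex (@mxtens_index n p)) /=; last first.
  by exists (@mxtens_unindex n p) => ij _; rewrite (mxtens_indexK, mxtens_unindexK).
transitivity (\sum_(j < n) \sum_(l < p) Mmx n p (mxtens_index (i, c))
    (mxtens_index (j, l)) * stack u (mxtens_index (j, l)) 0).
  by rewrite pair_bigA /=; apply: eq_bigr => -[j l] _.
rewrite [RHS]mxE mxtens_indexK /= mxE summxE mulr_sumr; apply: eq_bigr => j _.
rewrite (bigD1 c) //= big1 ?addr0 => [|l /negPf lc].
  rewrite tensmxE !mxE mxtens_indexK /= eqxx mulr1.
  by rewrite big_ord1 !mxE !mulr1.
by rewrite tensmxE [1%:M _ _]mxE eq_sym lc mulr0 mul0r.
Qed.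

Lemma consensus_errE u :
  consensus_err u = enorm (stack (fun i => u i - mean u)).
Proof. by rewrite /consensus_err Mmx_stack stackB. Qed.

(** The variance identity: the constant part and the deviation are orthogonal, so each is bounded in
    norm by the whole stacked vector. *)
Lemma sum_dot_mean u : (0 < n)%N ->
  \sum_i dot (u i - mean u) (u i - mean u) =
  \sum_i dot (u i) (u i) - n%:R * dot (mean u) (mean u).
Proof.
move=> n0; have := sum_mean u n0; set m := mean u => E.
transitivity (\sum_i (dot (u i) (u i) + (dot m m - 2 * dot (u i) m))).
  by apply: eq_bigr => i _; rewrite dotBl !dotBr (dotC m (u i)); ring.
rewrite big_split sumrB -mulr_sumr -(dot_suml u) E dotZl sumr_const card_ord /=.
by rewrite -[dot m m *+ n]mulr_natl; ring.
Qed.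

Lemma enorm_stack_mean u : (0 < n)%N ->
  enorm (stack (fun _ : 'I_n => mean u)) <= enorm (stack u).
Proof.
move=> n0; apply/enorm_leP; first exact: enorm_ge0.
rewrite sqr_enorm !dot_stack sumr_const card_ord -mulr_natl.
rewrite -subr_ge0 -sum_dot_mean // sumr_ge0 // => i _; exact: dot_ge0.
Qed.

Lemma consensus_err_le u : (0 < n)%N -> consensus_err u <= enorm (stack u).
Proof.
move=> n0; rewrite consensus_errE; apply/enorm_leP; first exact: enorm_ge0.
rewrite sqr_enorm !dot_stack sum_dot_mean // lerBlDr lerDl.
by rewrite mulr_ge0 ?dot_ge0.
Qed.

Lemma consensus_err_ge0 u : 0 <= consensus_err u.
Proof. exact: enorm_ge0. Qed.

Lemma consensus_errD u v :
  consensus_err (fun i => u i + v i) <= consensus_err u + consensus_err v.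
Proof.
rewrite !consensus_errE meanD (le_trans _ (enormD _ _)) // -stackD.
suff -> : (fun i => u i + v i - (mean u + mean v)) =
          (fun i => u i - mean u + (v i - mean v)) by [].
by apply/funext => i; rewrite addrACA opprD.
Qed.

Lemma consensus_errB u v :
  consensus_err (fun i => u i - v i) <= consensus_err u + consensus_err v.
Proof.
rewrite !consensus_errE meanB (le_trans _ (enormB _ _)) // -stackB.
suff -> : (fun i => u i - v i - (mean u - mean v)) =
          (fun i => u i - mean u - (v i - mean v)) by [].
by apply/funext => i; rewrite !opprB [mean v - _]addrC addrACA [- v i + _]addrC.
Qed.

End Stacking.

(** * Quadratic bounds for functions with Lipschitz gradient *)

Section Smooth.
Context {R : realType} {p : nat} (f : 'cV[R]_p -> R) (L : R).
Context (df : forall x, differentiable f x).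
Context (lipf : forall x y,
  enorm (gradient f x - gradient f y) <= L * enorm (x - y)).

Lemma derive_gradient x v : 'D_v f x = dot (gradient f x) v.
Proof.
rewrite deriveE // dotE.
have {1}-> : v = \sum_i v i 0 *: delta_mx i 0.
  rewrite {1}(matrix_sum_delta v); apply: eq_bigr => i _.
  by rewrite big_ord1.
rewrite linear_sum; apply: eq_bigr => i _ /=.
by rewrite linearZ /= mxE deriveE // mulrC.
Qed.

Lemma is_derive_line x d (t : R) :
  is_derive t 1 (fun s : R => f (x + s *: d)) (dot (gradient f (x + t *: d)) d).
Proof.
have E : (fun h : R => h^-1 *: (((fun s : R => f (x + s *: d)) \o shift t) (h *: 1)
           - f (x + t *: d))) =
         (fun h : R => h^-1 *: ((f \o shift (x + t *: d)) (h *: d)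
           - f (x + t *: d))).
  apply/funext => h /=; congr (_ *: (f _ - _)).
  by rewrite [h *: 1]mulr1 scalerDl addrCA.
have dv : derivable f (x + t *: d) d by exact: diff_derivable.
split; first by rewrite /derivable E.
by rewrite -derive_gradient /derive E.
Qed.

Lemma smooth_le x y :
  f y <= f x + dot (gradient f x) (y - x) + L / 2 * dot (y - x) (y - x).
Proof.
set d := y - x; set g := dot (gradient f x) d; set q := dot d d.
(* f along the segment minus the claimed bound; by the mean value theorem it suffices that its
   derivative is nonpositive, which is the Lipschitz condition. *)
pose h (t : R) := f (x + t *: d) - (t * g + L / 2 * q * t ^+ 2).
pose h' (t : R) := dot (gradient f (x + t *: d)) d - (g + L * q * t).
have dh (t : R) : is_derive t (1 : R) h (h' t).
  have d1 := is_derive_line x d t.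
  rewrite /h; apply: is_derive_eq.
  by rewrite /h'; set G := dot _ d; rewrite /GRing.scale /=; field.
have ch : {within `[0, 1], continuous h}.
  apply: continuous_subspaceT => t; apply: differentiable_continuous.
  by apply/derivable1_diffP; have [] := dh t.
have [c] := MVT ltr01 (fun t _ => dh t) ch.
rewrite in_itv /= => /andP[c0 c1]; rewrite subr0 mulr1 /h.
rewrite scale1r scale0r addr0 [x + d]addrC subrK => hE.
have : h' c <= 0.
  rewrite /h' opprD addrA -dotBl subr_le0.
  apply: (le_trans (dot_le_enorm _ _)).
  have cd : x + c *: d - x = c *: d by rewrite addrAC subrr add0r.
  have hl := lipf (x + c *: d) x; rewrite cd enormZ ?(ltW c0) // in hl.
  apply: (le_trans (ler_wpM2r (enorm_ge0 d) hl)).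
  by rewrite /q -sqr_enorm [X in X <= _](_ : _ = L * enorm d ^+ 2 * c) //; ring.
rewrite -hE; lra.
Qed.

End Smooth.

Lemma gradientN (R : realType) p (f : 'cV[R]_p -> R) x :
  differentiable f x -> gradient (- f) x = - gradient f x.
Proof.
move=> df; apply/colP => i; rewrite !mxE deriveN //.
exact: diff_derivable.
Qed.

Lemma smooth_ge (R : realType) p (f : 'cV[R]_p -> R) (L : R) x y :
  (forall x, differentiable f x) ->
  (forall x y, enorm (gradient f x - gradient f y) <= L * enorm (x - y)) ->
  f x + dot (gradient f x) (y - x) - L / 2 * dot (y - x) (y - x) <= f y.
Proof.
move=> df lf.
have df' z : differentiable (- f) z by exact: differentiableN.
have lf' u v : enorm (gradient (- f) u - gradient (- f) v) <= L * enorm (u - v).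
  by rewrite !gradientN // -opprD enormN.
have := smooth_le df' lf' x y; rewrite gradientN // dotNl.
by rewrite -![(- f) _]/(- f _); lra.
Qed.

(** * Bounds on the BFGS matrices *)

Section MemorylessBFGS.
Context {R : realType} {p : nat}.

(** The matrix order l I <= H <= u I, stated by quadratic forms rather than eigenvalues. *)
Definition between (l u : R) (H : 'M[R]_p) : Prop :=
  H^T = H /\ forall w, l * dot w w <= dot w (H *m w) <= u * dot w w.

Lemma between_weaken l' u' l u H :
  l' <= l -> u <= u' -> between l u H -> between l' u' H.
Proof.
move=> ll uu [sH bH]; split=> // w; case/andP: (bH w) => h1 h2.
by rewrite (le_trans _ h1) ?(le_trans h2) // ler_wpM2r ?dot_ge0.
Qed.

Lemma between1 : between 1 1 1%:M.
Proof. by split=> [|w]; rewrite ?trmx1 // mul1mx mul1r lexx. Qed.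

Lemma between_enorm l u H w : 0 <= l -> 0 <= u -> between l u H ->
  enorm (H *m w) <= u * enorm w.
Proof.
move=> l0 u0 [sH bH]; apply: psd_enorm_le => // z.
by case/andP: (bH z) => h1 ->; rewrite (le_trans _ h1) // mulr_ge0 ?dot_ge0.
Qed.

Lemma rank1_mulmx (u v w : 'cV[R]_p) : u *m v^T *m w = dot v w *: u.
Proof.
rewrite -mulmxA [v^T *m w]mx11_scalar mul_mx_scalar.
by congr (_ *: _); rewrite mxE.
Qed.

Lemma Bmx_sym (s y : 'cV[R]_p) : (Bmx s y)^T = Bmx s y.
Proof.
apply/matrixP => i j; rewrite /Bmx !mxE !big_ord1 !mxE [j == i]eq_sym.
rewrite (mulrC (s j 0) (y i 0)) (mulrC (y j 0) (s i 0)).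
by rewrite [_ + s i 0 * y j 0]addrC (mulrC (s j 0)).
Qed.

Lemma dot_Bmx (s y w : 'cV[R]_p) : dot w (Bmx s y *m w) =
  dot s y / dot y y * dot w w - 2 * dot s w * dot y w / dot y y
  + 2 * dot s w ^+ 2 / dot s y.
Proof.
rewrite /Bmx sqr_enorm !mulmxDl mulNmx mul_scalar_mx -!scalemxAl mulmxDl.
rewrite !rank1_mulmx !(dotDr, dotNr, dotZr) (dotC w s) (dotC w y); ring.
Qed.

(** The expression is the Gram determinant of s, y, w. Cauchy-Schwarz for the parts of s and w
    orthogonal to y, each scaled by |y|^2, gives it up to the factor |y|^6. *)
Lemma gram_det_ge0 (s y w : 'cV[R]_p) : 0 < dot y y ->
  0 <= dot s s * dot y y * dot w w + 2 * dot s y * dot s w * dot y w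
       - dot s s * dot y w ^+ 2 - dot y y * dot s w ^+ 2
       - dot s y ^+ 2 * dot w w.
Proof.
move=> b0; have := cauchy_schwarz (dot y y *: s - dot s y *: y)
                                  (dot y y *: w - dot y w *: y).
rewrite !(dotBl, dotBr, dotZl, dotZr) (dotC w y) (dotC y s).
set a := dot s s; set b := dot y y; set c := dot s y; set W := dot w w.
set q := dot s w; set r := dot y w => h.
have : 0 <= b ^+ 3 * (a * b * W + 2 * c * q * r - a * r ^+ 2 - b * q ^+ 2 - c ^+ 2 * W).
  by move: h; rewrite -subr_ge0; congr (_ <= _); ring.
by rewrite pmulr_rge0 // exprn_gt0.
Qed.

Lemma dot_gt0_neq0r (s y : 'cV[R]_p) : 0 < dot s y -> 0 < dot y y.
Proof.
by move=> c0; apply/dot_gt0/eqP => y0; move: c0; rewrite y0 dot0r ltxx.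
Qed.

(* On span (s, y) the matrix has trace [2 |s|^2 / s.y] and its inverse has
   trace [2 |y|^2 / s.y]; this is where the two bounds come from. *)
Lemma Bmx_between (s y : 'cV[R]_p) : 0 < dot s y ->
  between (dot s y / (2 * dot y y)) (2 * dot s s / dot s y) (Bmx s y).
Proof.
move=> c0; have b0 := dot_gt0_neq0r c0.
split; first exact: Bmx_sym.
move=> w; rewrite dot_Bmx.
have g0 := gram_det_ge0 s w b0; have h1 := cauchy_schwarz y w.
have h2 := cauchy_schwarz s w; move: c0 b0 g0 h1 h2.
set a := dot s s; set b := dot y y; set c := dot s y; set W := dot w w.
set q := dot s w; set r := dot y w => c0 b0 g0 h1 h2.
have a0 : 0 <= a by exact: dot_ge0.
apply/andP; split; rewrite -subr_ge0.
  have -> : c / b * W - 2 * q * r / b + 2 * q ^+ 2 / c - c / (2 * b) * W =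
     (2 * c)^-1 * ((c * r / b - 2 * q) ^+ 2 + c ^+ 2 / b ^+ 2 * (b * W - r ^+ 2)).
    by field; rewrite !gt_eqF.
  apply: mulr_ge0; first by rewrite invr_ge0 mulr_ge0 ?ltW.
  apply: addr_ge0; first exact: sqr_ge0.
  by rewrite mulr_ge0 ?subr_ge0 // divr_ge0 ?sqr_ge0.
(* The numerator is the Gram determinant plus two nonnegative terms. *)
have -> : 2 * a / c * W - (c / b * W - 2 * q * r / b + 2 * q ^+ 2 / c) =
   (b * c)^-1 * (a * b * W + 2 * c * q * r - a * r ^+ 2 - b * q ^+ 2 - c ^+ 2 * W
     + (b * (a * W - q ^+ 2) + a * r ^+ 2)).
  by field; rewrite !gt_eqF.
apply: mulr_ge0; first by rewrite invr_ge0 mulr_ge0 ?ltW.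
apply: addr_ge0 => //; apply: addr_ge0; last by rewrite mulr_ge0 ?sqr_ge0.
by rewrite mulr_ge0 ?subr_ge0 // ltW.
Qed.

End MemorylessBFGS.

Section MBFGSBounds.
Context {R : realType} {n p : nat} (D : setup R n p).
Context (HD : standing_assumptions D).

Let L0 := Lip_gt0 HD.
Let r0 := varrho_gt0 HD.

Lemma psi_gt0 : 0 < psi D.
Proof.
rewrite /psi !lt_min ltr01 (lbd_gt0 HD) /= divr_gt0 // mulr_gt0 //.
by rewrite exprn_gt0 // addr_gt0 ?mulr_gt0.
Qed.

Lemma psi_le1 : psi D <= 1.
Proof. by rewrite /psi !ge_min lexx. Qed.

Lemma Psi_ge1 : 1 <= Psi D.
Proof. by rewrite /Psi !le_max lexx. Qed.

Lemma Psi_gt0 : 0 < Psi D.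
Proof. exact: lt_le_trans ltr01 Psi_ge1. Qed.

(** A matrix passing the test has its spectrum in [l, u]. Otherwise h <= varrho + L, so y = dg + h s
    satisfies |y| <= (2 L + varrho) |s| and s.y >= varrho |s|^2; [Bmx_between] turns these into the
    last entries of [psi] and [Psi]. *)
Lemma MBFGS_between s yc dg : enorm dg <= Lip D * enorm s ->
  between (psi D) (Psi D) (MBFGS D s yc dg).
Proof.
move=> hdg; rewrite /MBFGS.
case: eqVneq => [_|s0]; first exact: between_weaken psi_le1 Psi_ge1 between1.
case: ifP => [/andP[c0 /asboolP eB]|_].
  apply: (@between_weaken _ _ _ _ (lbd D) (ubd D)).
  - by rewrite /psi !ge_min lexx orbT.
  - by rewrite /Psi !le_max lexx orbT.
  split=> [|w]; first exact: Bmx_sym.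
  rewrite rayleigh_le ?rayleigh_ge ?Bmx_sym // => a /eB /andP[] //.
have a0 : 0 < enorm s by rewrite lt_def enorm_ge0 enorm_eq0 s0.
set h := _ + Num.max _ _; set y := dg + h *: s.
have rh : varrho D <= h by rewrite lerDl le_max lexx orbT.
have h0 : 0 <= h by rewrite (le_trans _ rh) ?ltW.
have hc : - dot s dg / enorm s ^+ 2 <= Lip D.
  rewrite ler_pdivrMr ?exprn_gt0 // lerNl.
  apply: le_trans (dot_ge_enorm s dg); rewrite lerN2 expr2 mulrA.
  by rewrite (mulrC (enorm s) (enorm dg)); apply: ler_wpM2r; first exact: ltW.
have hL : h <= varrho D + Lip D by rewrite lerD2l ge_max hc ltW.
have yE : enorm y <= (2 * Lip D + varrho D) * enorm s.
  rewrite (le_trans (enormD _ _)) // enormZ //.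
  have : h * enorm s <= (varrho D + Lip D) * enorm s by rewrite ler_wpM2r // ltW.
  lra.
have cE : varrho D * enorm s ^+ 2 <= dot s y.
  rewrite dotDr dotZr -sqr_enorm /h mulrDl.
  suff : - dot s dg <= Num.max (- dot s dg / enorm s ^+ 2) 0 * enorm s ^+ 2 by lra.
  by rewrite -ler_pdivrMr ?exprn_gt0 // le_max lexx.
have c0 : 0 < dot s y by rewrite (lt_le_trans _ cE) // mulr_gt0 ?exprn_gt0.
have b0 := dot_gt0_neq0r c0.
apply: between_weaken (Bmx_between c0).
  rewrite (@le_trans _ _ (varrho D / (2 * (2 * Lip D + varrho D) ^+ 2))) //.
    by rewrite /psi !ge_min lexx orbT.
  have Lr0 : 0 < 2 * Lip D + varrho D by rewrite addr_gt0 ?mulr_gt0.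
  have hy : dot y y <= (2 * Lip D + varrho D) ^+ 2 * enorm s ^+ 2.
    by rewrite -exprMn -sqr_enorm lerXn2r ?nnegrE ?enorm_ge0 // mulr_ge0 ?ltW.
  rewrite ler_pdivlMr ?mulr_gt0 //; apply: le_trans cE.
  have -> : varrho D * enorm s ^+ 2 = varrho D / (2 * (2 * Lip D + varrho D) ^+ 2)
      * (2 * ((2 * Lip D + varrho D) ^+ 2 * enorm s ^+ 2)).
    by field; rewrite gt_eqF.
  apply: ler_wpM2l; last by rewrite ler_pM2l.
  by rewrite divr_ge0 ?mulr_ge0 ?sqr_ge0 // ltW.
apply: (@le_trans _ _ (2 / varrho D)); last by rewrite /Psi !le_max lexx orbT.
rewrite ler_pdivrMr // -sqr_enorm mulrAC ler_pdivlMr //.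
by rewrite -mulrA ler_wpM2l // mulrC.
Qed.

End MBFGSBounds.

(** * Contraction by the mixing matrix *)

(** The Kronecker product of A with the identity acts on each of the p coordinates separately. *)
Lemma enorm_stack_mulmx {R : realType} n p (A : 'M[R]_n) (s : R)
    (u : 'I_n -> 'cV[R]_p) : 0 <= s ->
  (forall w, enorm (A *m w) <= s * enorm w) ->
  enorm (stack (fun i => \sum_j A i j *: u j)) <= s * enorm (stack u).
Proof.
move=> s0 hA; apply/enorm_leP; first by rewrite mulr_ge0 ?enorm_ge0.
pose w c : 'cV[R]_n := \col_j u j c 0.
rewrite exprMn sqr_enorm !dot_stack.
under eq_bigr do rewrite dotE.
under [in leRHS]eq_bigr do rewrite dotE.
rewrite exchange_big [in leRHS]exchange_big mulr_sumr /=.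
apply: ler_sum => c _.
have -> : \sum_i u i c 0 * u i c 0 = enorm (w c) ^+ 2.
  by rewrite sqr_enorm dotE; apply: eq_bigr => i _; rewrite !mxE.
have -> : \sum_i (\sum_j A i j *: u j) c 0 * (\sum_j A i j *: u j) c 0 =
          enorm (A *m w c) ^+ 2.
  rewrite sqr_enorm dotE; apply: eq_bigr => i _.
  have -> // : (\sum_j A i j *: u j) c 0 = (A *m w c) i 0.
  by rewrite summxE mxE; apply: eq_bigr => j _; rewrite !mxE.
by rewrite -exprMn lerXn2r ?nnegrE ?mulr_ge0 ?enorm_ge0.
Qed.

Section Mixing.
Context {R : realType} {n p : nat} (D : setup R n p).
Context (HD : standing_assumptions D).

(** For n = 0 there would be no eigenvalue, and [sigma] would be the default value 0. *)
Lemma node_gt0 : (0 < n)%N.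
Proof.
have [e charE sE] := sigma_def HD.
have := size_char_poly (Wt D); rewrite charE size_prod_XsubC => -[<-].
case: e {charE} sE => [|a e //] /= sE.
by have := sigma_gt0 HD; rewrite sE ltxx.
Qed.

Let N0 : (n%:R : R) != 0. Proof. by rewrite pnatr_eq0 -lt0n node_gt0. Qed.

Lemma Wt_ge0 i j : 0 <= Wt D i j.
Proof.
have [/(Wt_gt0 HD)/ltW //|/(Wt_eq0 HD) ->] := boolP (j \in nbhd D i).
exact: lexx.
Qed.

Definition Wt_centered : 'M[R]_n := Wt D - const_mx n%:R^-1.

Lemma Wt_centered_sym : Wt_centered^T = Wt_centered.
Proof. by rewrite /Wt_centered linearB /= (Wt_sym HD) trmx_const. Qed.

(** Double stochasticity makes the Dirichlet energy of a fixed point vanish, so w agrees across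
    every edge, and connectivity does the rest. *)
Lemma Wt_fixpoint_const (w : 'cV[R]_n) : Wt D *m w = w -> forall i j, w i 0 = w j 0.
Proof.
move=> Ww.
have S0 : \sum_i \sum_j Wt D i j * (w i 0 - w j 0) ^+ 2 = 0.
  have E i : \sum_j Wt D i j * (w i 0 - w j 0) ^+ 2 =
      \sum_j Wt D i j * w j 0 ^+ 2 - w i 0 ^+ 2.
    transitivity (\sum_j (Wt D i j * w j 0 ^+ 2 + (w i 0 ^+ 2 * Wt D i j -
        2 * w i 0 * (Wt D i j * w j 0)))).
      by apply: eq_bigr => j _; ring.
    rewrite big_split sumrB -!mulr_sumr (Wt_row_sum HD) /=.
    have -> : \sum_j Wt D i j * w j 0 = w i 0 by rewrite -{2}Ww mxE.
    by ring.
  under eq_bigr do rewrite E.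
  rewrite sumrB exchange_big /=.
  under eq_bigr do rewrite -mulr_suml (Wt_col_sum HD) mul1r.
  by rewrite subrr.
have edgeE i j : edge D i j -> w i 0 = w j 0.
  move=> eij; move/eqP: S0; rewrite psumr_eq0; last first.
    by move=> k _; rewrite sumr_ge0 // => l _; rewrite mulr_ge0 ?Wt_ge0 ?sqr_ge0.
  move/allP/(_ i (mem_index_enum i)); rewrite /= psumr_eq0; last first.
    by move=> l _; rewrite mulr_ge0 ?Wt_ge0 ?sqr_ge0.
  move/allP/(_ j (mem_index_enum j)); rewrite /= mulf_eq0 sqrf_eq0 subr_eq0.
  have : 0 < Wt D i j by apply: (Wt_gt0 HD); rewrite inE eij orbT.
  by move=> /gt_eqF -> /eqP.
move=> i j; have /connectP[q + ->] := edge_connected HD i j.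
elim: q i => //= k q IH i /andP[/edgeE -> ]; exact: IH.
Qed.

(** At most one eigenvalue in the list exceeds the second largest magnitude, and 1 is such an
    eigenvalue since sigma < 1. *)
Lemma Wt_big_eigenvalue a : eigenvalue (Wt D) a -> sigma D < `|a| -> a = 1.
Proof.
move=> ea sa; have [e charE sE] := sigma_def HD.
pose m := sort (fun a b => b <= a) [seq `|a| | a <- e].
pose P := fun x : R => sigma D < `|x|.
have ine b : eigenvalue (Wt D) b -> b \in e.
  by rewrite eigenvalue_root_char charE root_prod_XsubC.
have e1 : eigenvalue (Wt D) 1.
  apply/eigenvalueP; exists (const_mx 1).
    apply/rowP => j; rewrite !mxE mul1r.
    by under eq_bigr do rewrite mxE mul1r; exact: (Wt_col_sum HD).
  apply/eqP => /rowP/(_ (Ordinal node_gt0)); rewrite !mxE => /eqP.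
  by rewrite oner_eq0.
have countP : (count P e <= 1)%N.
  have -> : count P e = count (fun x => sigma D < x) m.
    by rewrite (permP (permEl (perm_sort _ _))) count_map.
  have : sorted (fun a b : R => b <= a) m.
    by apply: sort_sorted => x y; rewrite orbC le_total.
  have : sigma D = m`_1 by [].
  case: m => [|x [|y m]] //=; first by case: (_ < _).
  move=> ->; rewrite ltxx => /andP[_].
  rewrite path_sortedE; last by move=> ? ? ? h1 h2; exact: le_trans h2 h1.
  case/andP => /allP hm _; rewrite add0n.
  rewrite (_ : count _ m = 0%N) ?addn0 ?leq_b1 //.
  by apply/eqP; rewrite -leqn0 leqNgt -has_count; apply/hasPn => z /hm; rewrite leNgt.
have ina : a \in [seq x <- e | P x] by rewrite mem_filter ine // andbT.
have in1 : 1 \in [seq x <- e | P x].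
  by rewrite mem_filter ine // andbT /P normr1 (sigma_lt1 HD).
move: countP ina in1; rewrite -size_filter.
by case: [seq x <- e | P x] => [|x [|]] //= _; rewrite !inE => /eqP -> /eqP ->.
Qed.

Lemma Wt_centered_eigenvalue a : eigenvalue Wt_centered a -> `|a| <= sigma D.
Proof.
move=> ea; have [->|a0] := eqVneq a 0; first by rewrite normr0 ltW ?(sigma_gt0 HD).
have [w w0 wE] := eigenvalue_vector Wt_centered_sym ea.
have rE i : \sum_j Wt_centered i j * w j 0 = a * w i 0.
  by move/colP/(_ i): wE; rewrite !mxE.
(* The columns of [Wt_centered] sum to 0, hence so do the entries of a w, and a is nonzero. *)
have sw : \sum_i w i 0 = 0.
  apply: (mulfI a0); rewrite mulr0 mulr_sumr.
  under eq_bigr do rewrite -rE.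
  rewrite exchange_big big1 // => j _; rewrite -mulr_suml.
  under eq_bigr do rewrite !mxE.
  rewrite sumrB (Wt_col_sum HD) sumr_const card_ord -[n%:R^-1 *+ n]mulr_natl.
  by rewrite mulfV // subrr mul0r.
have WwE : Wt D *m w = a *: w.
  rewrite -wE mulmxBl -[LHS]subr0; congr (_ - _); apply/esym/colP => i.
  by rewrite !mxE; under eq_bigr do rewrite mxE; rewrite -mulr_sumr sw mulr0.
rewrite leNgt; apply/negP => sa.
have a1 : a = 1.
  apply: Wt_big_eigenvalue => //; apply/eigenvalueP; exists w^T; last by rewrite trmx_eq0.
  by rewrite -(Wt_sym HD) -trmx_mul WwE linearZ.
have Ww : Wt D *m w = w by rewrite WwE a1 scale1r.
have cw := Wt_fixpoint_const Ww.
case/eqP: w0; apply/colP => i; rewrite mxE.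
have : \sum_(j < n) w j 0 = \sum_(j < n) w i 0 by apply: eq_bigr => j _; exact: cw.
rewrite sw sumr_const card_ord => /esym/eqP.
by rewrite mulrn_eq0 eqn0Ngt node_gt0 => /eqP.
Qed.

Lemma mixE (u : 'I_n -> 'cV[R]_p) i : mix D u i = \sum_j Wt D i j *: u j.
Proof.
rewrite /mix [RHS](bigID (fun j => j \in nbhd D i)) /= [X in _ + X]big1 ?addr0 //.
by move=> j /(Wt_eq0 HD) ->; rewrite scale0r.
Qed.

Lemma mean_mix (u : 'I_n -> 'cV[R]_p) : mean (mix D u) = mean u.
Proof.
congr (_ *: _); under eq_bigr do rewrite mixE.
rewrite exchange_big /=; apply: eq_bigr => j _.
by rewrite -scaler_suml (Wt_col_sum HD) scale1r.
Qed.

Lemma consensus_err_mix (u : 'I_n -> 'cV[R]_p) :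
  consensus_err (mix D u) <= sigma D * consensus_err u.
Proof.
rewrite !consensus_errE mean_mix.
have -> : (fun i => mix D u i - mean u) =
          (fun i => \sum_j Wt_centered i j *: (u j - mean u)).
  apply/funext => i; rewrite mixE.
  under [RHS]eq_bigr do rewrite scalerBr.
  rewrite sumrB -scaler_suml.
  under [X in _ = X - _]eq_bigr do rewrite !mxE scalerBl.
  rewrite sumrB -scaler_sumr -/(mean u).
  under [X in _ = _ - X *: _]eq_bigr do rewrite !mxE.
  rewrite sumrB (Wt_row_sum HD) sumr_const card_ord -[n%:R^-1 *+ n]mulr_natl mulfV //.
  by rewrite subrr scale0r subr0.
apply: enorm_stack_mulmx; first exact/ltW/(sigma_gt0 HD).
move=> w; apply: sym_enorm_le; first exact: Wt_centered_sym.
  exact/ltW/(sigma_gt0 HD).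
exact: Wt_centered_eigenvalue.
Qed.

End Mixing.

(** * Event-triggered communication *)

Section Communication.
Context {R : realType} {n p : nat} (D : setup R n p).
Context (HD : standing_assumptions D).
Context (t : nat) (u : 'I_n -> 'cV[R]_p).

Local Notation uk s := (etc_iter D t u s).1.
Local Notation uh s := (etc_iter D t u s).2.
Local Notation bound s := (eta_seq D t * tau_seq D s).

Lemma mixB (v w : 'I_n -> 'cV[R]_p) i :
  mix D (fun j => v j - w j) i = mix D v i - mix D w i.
Proof.
by rewrite /mix -sumrB; apply: eq_bigr => j _; rewrite scalerBr.
Qed.

Lemma etc_iterS s : etc_iter D t u s.+1 =
  (fun i => uk s i - (uh s i - mix D (uh s) i),
   fun i => if bound s.+1 <= enorm (uk s i - (uh s i - mix D (uh s) i) - uh s i)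
            then uk s i - (uh s i - mix D (uh s) i) else uh s i).
Proof. by rewrite /=; case: (etc_iter D t u s). Qed.

Lemma etc_gap s i : enorm (uh s i - uk s i) <= bound s.
Proof.
have b0 r : 0 <= bound r by rewrite mulr_ge0 ?(eta_ge0 HD) ?(tau_ge0 HD).
case: s => [|s]; first by rewrite /= subrr enorm0.
rewrite etc_iterS /=; case: ifP => [_|/negbT]; first by rewrite subrr enorm0.
by rewrite -ltNge enorm_distC => /ltW.
Qed.

Lemma etc_mean s : mean (uk s) = mean u.
Proof.
elim: s => [//|s IH]; rewrite etc_iterS /= meanB meanB.
by rewrite [X in _ - (_ - X)](mean_mix HD) subrr subr0.
Qed.

(** With e the broadcast gap, u^{s+1} = W u^s - (e - W e). The first term contracts by sigma, and
    the second has at most twice the consensus error of e, itself at most sqrt n times the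
    threshold. *)
Lemma etc_consensus s : consensus_err (uk s) <=
  sigma D ^+ s * consensus_err u + 2 * (Num.sqrt n%:R * eta_seq D t)
    * \sum_(k < s) sigma D ^+ k * tau_seq D (s - 1 - k)%N.
Proof.
elim: s => [|s IH]; first by rewrite big_ord0 mulr0 addr0 expr0 mul1r.
pose e i := uh s i - uk s i.
have -> : uk s.+1 = fun i => mix D (uk s) i - (e i - mix D e i).
  rewrite etc_iterS /=; apply/funext => i; rewrite /e mixB.
  by rewrite !opprB [RHS]addrA subrKC addrCA.
rewrite (le_trans (consensus_errB _ _)) //.
have he : consensus_err e <= Num.sqrt n%:R * bound s.
  apply: le_trans (consensus_err_le _ (node_gt0 HD)) _.
  apply: enorm_stack_bound => [|i]; last exact: etc_gap.
  by rewrite mulr_ge0 ?(eta_ge0 HD) ?(tau_ge0 HD).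
have h1 := consensus_err_mix HD (uk s).
have h2 := consensus_errB e (mix D e).
have h3 : consensus_err (mix D e) <= consensus_err e.
  rewrite (le_trans (consensus_err_mix HD e)) // ler_piMl ?consensus_err_ge0 //.
  exact/ltW/(sigma_lt1 HD).
have h4 := ler_wpM2l (ltW (sigma_gt0 HD)) IH.
(* The term k = 0 is the current threshold tau_s; the others are sigma times the previous sum. *)
rewrite big_ord_recl expr0 mul1r subn1 subn0 /=.
under eq_bigr => k _ do rewrite /bump /= add1n exprS -mulrA subnS -subn1 subnAC.
by rewrite -mulr_sumr exprS; lra.
Qed.

End Communication.

(** * Local updates *)

Section LocalUpdates.
Context {R : realType} {n p : nat} (D : setup R n p).
Context (HD : standing_assumptions D).
Context (alpha_Gamma : 2 * Gamma D * Lip D * alpha D <= 1).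
Context (alpha_Psi : alpha D * Lip D * Psi D ^+ 2 <= psi D).
Context (S : state R n p) (i : 'I_n).
Context (bH : between (psi D) (Psi D) (st_H S i)).

Local Notation L := (Lip D).
Local Notation a := (alpha D).
Local Notation x := (st_x S i).
Local Notation v := (st_v S i).
Local Notation f := (fobj D i).
Local Notation g := (gradient f).
Local Notation w k := (local_iter D S i k).
Local Notation skip k := (local_skip D S i (w k)).
Local Notation dir k := (lH (w k) *m lv (w k)).

Definition local_out : 'cV[R]_p :=
  lx (w (Kg D).-1) - a *: (lH (w (Kg D).-1) *m lv (w (Kg D).-1)).

Let L0 : 0 <= L := ltW (Lip_gt0 HD).
Let a0 : 0 < a := alpha_gt0 HD.
Let Psi0 : 0 < Psi D := Psi_gt0 D.
Let psi0 : 0 < psi D := psi_gt0 HD.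
Let gam0 : 0 < gam D := gam_gt0 HD.
Let fdiff z : differentiable f z := (fobj_C1 HD i).1 z.
Let flip y z := grad_lipschitz HD i y z.

Lemma Gamma_gt0 : 0 < Gamma D.
Proof. by rewrite addr_gt0 ?mulr_gt0. Qed.

Lemma Cloc_den_gt0 : 0 < psi D - L / 2 * a * Psi D ^+ 2.
Proof. move: alpha_Psi psi0; rewrite (mulrC a L); lra. Qed.

Lemma local_iterS k : w k.+1 = local_step D S i (w k).
Proof. by []. Qed.

(** An executed step adds the same gradient difference to v and to the local gradient, so the
    tracking error is invariant during the local phase. *)
Lemma local_iterP k :
  lv (w k) - g (lx (w k)) = v - g x /\ between (psi D) (Psi D) (lH (w k)).
Proof.
elim: k => [//|k [IHv IHH]]; rewrite local_iterS /local_step.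
case: ifP => // _ /=; split; first by rewrite -IHv addrA addrAC addrK.
by apply: MBFGS_between => //; exact: flip.
Qed.

Lemma local_dir_le k : enorm (dir k) <= Psi D * enorm (lv (w k)).
Proof.
by have [_ h] := local_iterP k; apply: between_enorm h; exact: ltW.
Qed.

(** As c <= Gamma and 2 Gamma L alpha <= 1, the gradient has changed by at most |v| / 2. *)
Lemma local_v_le k c : enorm (lx (w k) - x) <= c * a * enorm v ->
  2 * c <= 2 * Gamma D -> enorm (lv (w k)) <= 3 / 2 * enorm v.
Proof.
move=> hx hc; have [hv _] := local_iterP k.
have -> : lv (w k) = v + (g (lx (w k)) - g x).
  by rewrite addrCA -hv addrC subrK.
have h1 := flip (lx (w k)) x; have h2 := ler_wpM2l L0 hx.
have h3 := enormD v (g (lx (w k)) - g x).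
have h4 : 2 * c * (L * a * enorm v) <= 2 * Gamma D * (L * a * enorm v).
  by rewrite ler_wpM2r // !mulr_ge0 ?enorm_ge0 // ltW.
have h5 := ler_wpM2r (enorm_ge0 v) alpha_Gamma.
lra.
Qed.

(** An executed step starts within gamma alpha |v| of x, by the skip test, and has length at most
    3/2 Psi alpha |v|. *)
Lemma local_dist k : enorm (lx (w k) - x) <= (gam D + 2 * Psi D) * a * enorm v.
Proof.
elim: k => [|k IH].
  by rewrite subrr enorm0 !mulr_ge0 ?enorm_ge0 // ?addr_ge0 ?mulr_ge0 // ltW.
rewrite local_iterS /local_step; case: ifP => [//|/negbT].
rewrite negb_or => /andP[_]; rewrite -leNgt => hx /=.
have hv : enorm (lv (w k)) <= 3 / 2 * enorm v.
  by apply: local_v_le hx _; rewrite /Gamma; move: Psi0; lra.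
rewrite addrAC (le_trans (enormB _ _)) // enormZ ?(ltW a0) //.
have h1 := ler_wpM2l (ltW a0) (local_dir_le k).
have h2 := ler_wpM2l (mulr_ge0 (ltW a0) (ltW Psi0)) hv.
have h3 : 0 <= Psi D * a * enorm v by rewrite !mulr_ge0 ?enorm_ge0 // ltW.
lra.
Qed.

(** The mandatory step is unguarded: it starts within (gamma + 2 Psi) alpha |v| of x and adds at
    most 3/2 Psi alpha |v|. *)
Lemma local_out_dist : enorm (x - local_out) <= Gamma D * a * enorm v.
Proof.
set k := (Kg D).-1; have hx := local_dist k.
have hv : enorm (lv (w k)) <= 3 / 2 * enorm v.
  by apply: local_v_le hx _; rewrite /Gamma; move: Psi0; lra.
rewrite /local_out -/k enorm_distC addrAC (le_trans (enormB _ _)) //.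
rewrite enormZ ?(ltW a0) //.
have h1 := ler_wpM2l (ltW a0) (local_dir_le k).
have h2 := ler_wpM2l (mulr_ge0 (ltW a0) (ltW Psi0)) hv.
have h3 : 0 <= Psi D * a * enorm v by rewrite !mulr_ge0 ?enorm_ge0 // ltW.
by rewrite /Gamma; lra.
Qed.

(* [lv (w k)] is the gradient at [lx (w k)] of this tilted objective, which
   every executed step therefore decreases. *)
Definition tilted (z : 'cV[R]_p) : R := f z + dot (v - g x) z.

Lemma tilted_step k :
  tilted (lx (w k) - a *: dir k)
    + a * (psi D - L / 2 * a * Psi D ^+ 2) * enorm (lv (w k)) ^+ 2
  <= tilted (lx (w k)).
Proof.
have [hv [_ hH]] := local_iterP k; set z := lx (w k).
have := smooth_le fdiff flip z (z - a *: dir k).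
rewrite [z - _ - z]addrAC subrr add0r dotNl !dotNr opprK !dotZr !dotZl.
have /andP[h1 _] := hH (lv (w k)).
have h2 : dot (dir k) (dir k) <= Psi D ^+ 2 * enorm (lv (w k)) ^+ 2.
  rewrite -sqr_enorm -exprMn lerXn2r ?nnegrE ?enorm_ge0 ?local_dir_le //.
  by rewrite mulr_ge0 ?enorm_ge0 // ltW.
rewrite -sqr_enorm in h1.
have h3 := ler_wpM2l (ltW a0) h1.
have h4 : L / 2 * a ^+ 2 * dot (dir k) (dir k) <=
          L / 2 * a ^+ 2 * (Psi D ^+ 2 * enorm (lv (w k)) ^+ 2).
  by rewrite ler_wpM2l // mulr_ge0 ?sqr_ge0 // divr_ge0.
rewrite /tilted dotBr dotZr -/z.
have -> : dot (v - g x) (dir k) = dot (lv (w k)) (dir k) - dot (g z) (dir k).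
  by rewrite -hv dotBl.
lra.
Qed.

(** The gradient of [tilted] at x is v, and the tilt leaves the Lipschitz constant unchanged. *)
Lemma tilted_ge z :
  tilted x - dot v (x - z) - L / 2 * dot (x - z) (x - z) <= tilted z.
Proof.
have := @smooth_ge _ _ f L x z fdiff flip.
rewrite -[z - x]opprB !dotNr dotNl opprK /tilted.
have : dot (v - g x) z = dot (v - g x) x - dot v (x - z) + dot (g x) (x - z).
  by rewrite !(dotBl, dotBr); ring.
lra.
Qed.

Definition exec_sum k : R := \sum_(j < k) (~~ skip j)%:R * enorm (lv (w j)) ^+ 2.

Lemma exec_sumS k :
  exec_sum k.+1 = exec_sum k + (~~ skip k)%:R * enorm (lv (w k)) ^+ 2.
Proof. exact: big_ord_recr. Qed.

Lemma tilted_descent k :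
  tilted (lx (w k)) + a * (psi D - L / 2 * a * Psi D ^+ 2) * exec_sum k
  <= tilted x.
Proof.
elim: k => [|k IH]; first by rewrite /exec_sum big_ord0 mulr0 addr0.
rewrite exec_sumS.
move: (tilted_step k); rewrite local_iterS /local_step.
by case: ifP => _ /=; lra.
Qed.

(** The first executed step starts with v itself; if there has been none, the current vector is
    still v. *)
Lemma exec_sum_ge k : enorm v ^+ 2 <= exec_sum k + enorm (lv (w k)) ^+ 2.
Proof.
elim: k => [|k IH]; first by rewrite /exec_sum big_ord0 add0r.
rewrite exec_sumS local_iterS /local_step.
have := sqr_ge0 (enorm (lv (w k.+1))); rewrite local_iterS /local_step.
by case: ifP => _ /=; lra.
Qed.

(** The decrease of [tilted] from x to [local_out], mandatory step included, is compared with its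
    lower bound at [local_out]. *)
Lemma local_descent :
  a * (psi D - L / 2 * a * Psi D ^+ 2)
    * (exec_sum (Kg D).-1 + enorm (lv (w (Kg D).-1)) ^+ 2)
  <= dot v (x - local_out) + L / 2 * dot (x - local_out) (x - local_out).
Proof.
have h1 := tilted_step (Kg D).-1; have h2 := tilted_descent (Kg D).-1.
have h3 := tilted_ge local_out; rewrite -/local_out in h1.
lra.
Qed.

Lemma local_out_descent :
  a * (psi D / 4 - a * L * Psi D ^+ 2 / 8) * enorm v ^+ 2
    - L / 2 * enorm (x - local_out) ^+ 2
  <= dot v (x - local_out).
Proof.
have c0 := mulr_gt0 a0 Cloc_den_gt0.
have h := ler_wpM2l (ltW c0) (exec_sum_ge (Kg D).-1).
have := le_trans h local_descent; rewrite [enorm (x - _) ^+ 2]sqr_enorm.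
(* Only a quarter of the available decrease is kept, which is the form that enters [Cf]. *)
have : 0 <= a * (psi D - L / 2 * a * Psi D ^+ 2) * enorm v ^+ 2.
  by rewrite mulr_ge0 ?sqr_ge0 // ltW.
lra.
Qed.

(** An executed step failed the first skip test, so epst <= alpha Psi |v^{t,k}|, and the count is
    controlled by [exec_sum]. By [local_descent] this is at most an expression in the displacement,
    whose norm is at most Gamma alpha |v|; the resulting ratio is [Cloc]. *)
Lemma nlocal_le :
  (\sum_(k < (Kg D).-1) ~~ skip k)%N%:R * epst D ^+ 2
  <= a ^+ 2 * Cloc D * enorm v ^+ 2.
Proof.
have e0 : 0 < epst D := epst_gt0 HD.
have h1 : (\sum_(k < (Kg D).-1) ~~ skip k)%N%:R * epst D ^+ 2
    <= a ^+ 2 * Psi D ^+ 2 * exec_sum (Kg D).-1.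
  rewrite natr_sum mulr_suml /exec_sum mulr_sumr; apply: ler_sum => k _.
  case: (boolP (skip k)) => /= [_|]; first by rewrite !mul0r mulr0.
  rewrite !mul1r /local_skip negb_or -leNgt ge_max => /andP[/andP[_ he] _].
  have hk : epst D <= a * Psi D * enorm (lv (w k)).
    apply: (le_trans he); rewrite -mulrA; apply: ler_wpM2l; first exact: ltW.
    exact: local_dir_le.
  by rewrite -!exprMn lerXn2r ?nnegrE ?(le_trans (ltW e0) hk) ?(ltW e0).
have den0 := Cloc_den_gt0; have c0 := mulr_gt0 a0 den0.
apply: (le_trans h1).
have -> : a ^+ 2 * Cloc D * enorm v ^+ 2 = a ^+ 2 * Psi D ^+ 2 *
   ((Gamma D * a + L / 2 * Gamma D ^+ 2 * a ^+ 2) * enorm v ^+ 2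
     / (a * (psi D - L / 2 * a * Psi D ^+ 2))).
  rewrite /Cloc; field; rewrite (gt_eqF a0) andbT gt_eqF //.
  by move: den0; lra.
apply: ler_wpM2l; first by rewrite mulr_ge0 ?sqr_ge0.
rewrite ler_pdivlMr //.
have h2 := local_descent; have h3 := local_out_dist.
have h4 := dot_le_enorm v (x - local_out).
have h5 := ler_wpM2l (enorm_ge0 v) h3.
have h6 : dot (x - local_out) (x - local_out) <= (Gamma D * a * enorm v) ^+ 2.
  by rewrite -sqr_enorm lerXn2r ?nnegrE ?enorm_ge0 // (le_trans _ h3) ?enorm_ge0.
have h7 : L / 2 * dot (x - local_out) (x - local_out) <=
    L / 2 * (Gamma D * a * enorm v) ^+ 2 by rewrite ler_wpM2l // divr_ge0.
have h8 : 0 <= a * (psi D - L / 2 * a * Psi D ^+ 2) * enorm (lv (w (Kg D).-1)) ^+ 2.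
  by rewrite mulr_ge0 ?sqr_ge0 // ltW.
lra.
Qed.

End LocalUpdates.

(** * Scalar inequalities of the potential descent *)

Section ScalarInequalities.
Context {R : realType}.

(** Young's inequality, weighted so that the coefficient of A^2 only grows from r^2 to the midpoint
    of r^2 and 1. *)
Lemma young_contraction (r A q : R) : r ^+ 2 < 1 ->
  (r * A + q) ^+ 2 <= (1 + r ^+ 2) / 2 * A ^+ 2
                      + (1 + r ^+ 2) / (1 - r ^+ 2) * q ^+ 2.
Proof.
move=> s1; have d0 : 0 < 1 - r ^+ 2 by rewrite subr_gt0.
rewrite -subr_ge0 [leRHS](_ : _ = ((1 - r ^+ 2) * A - 2 * r * q) ^+ 2
   / (2 * (1 - r ^+ 2))); last by field; rewrite gt_eqF.
by rewrite divr_ge0 ?sqr_ge0 ?mulr_ge0 ?ltW.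
Qed.

Lemma young_weighted (c a b : R) : 0 < c -> a * b <= c * a ^+ 2 + b ^+ 2 / (4 * c).
Proof.
move=> c0; rewrite -subr_ge0 [leRHS](_ : _ = (2 * c * a - b) ^+ 2 / (4 * c));
  last by field; rewrite gt_eqF.
by rewrite divr_ge0 ?sqr_ge0 ?mulr_ge0 ?ltW.
Qed.

Lemma contraction_sqr (r A A' d e : R) : 0 <= A' -> r ^+ 2 < 1 ->
  A' <= r * (A + d) + 2 * e ->
  A' ^+ 2 <= (1 + r ^+ 2) / 2 * A ^+ 2
    + 2 * r ^+ 2 * ((1 + r ^+ 2) / (1 - r ^+ 2)) * d ^+ 2
    + 8 * ((1 + r ^+ 2) / (1 - r ^+ 2)) * e ^+ 2.
Proof.
move=> A'0 s1 hA; have d0 : 0 < 1 - r ^+ 2 by rewrite subr_gt0.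
have c0 : 0 <= (1 + r ^+ 2) / (1 - r ^+ 2).
  by apply: divr_ge0; [rewrite addr_ge0 ?sqr_ge0|exact: ltW].
have h1 : A' ^+ 2 <= (r * A + (r * d + 2 * e)) ^+ 2.
  have hp := le_trans A'0 hA.
  have -> : r * A + (r * d + 2 * e) = r * (A + d) + 2 * e by ring.
  by rewrite lerXn2r ?nnegrE.
apply: (le_trans h1); apply: (le_trans (young_contraction _ _ s1)).
have h2 : (r * d + 2 * e) ^+ 2 <= 2 * r ^+ 2 * d ^+ 2 + 8 * e ^+ 2.
  by have := sqr_ge0 (r * d - 2 * e); lra.
have := ler_wpM2l c0 h2; lra.
Qed.

Context (r N L : R).
Context (r0 : 0 < r) (r1 : r < 1) (N0 : 0 < N) (L0 : 0 < L).
Local Notation s := (r ^+ 2).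

(** This and the next two constants are the weight in [potential], [Cv] and [Cnet], with r standing
    for sigma^Kc. *)
Definition potential_weight : R := (1 - s) ^+ 2 / (288 * (1 + s) * L ^+ 2).
Definition v_rate : R := (1 - s) ^+ 3 / (1152 * (1 + s) * L ^+ 2).
Definition net_const : R :=
  L + 2 * L ^+ 2 / (N * (1 - s))
  + 288 * (1 + s) * L ^+ 2 / (N * (1 - s) ^+ 3)
  + 2 * N * s * ((1 + s) / (1 - s)) + 7 / 24 * N * s * (1 - s).

Lemma sqr_lt1 : s < 1.
Proof. by rewrite expr_lt1 // ltW. Qed.

Lemma net_const_gt0 : 0 < net_const.
Proof.
have d0 : 0 < 1 - s by rewrite subr_gt0 sqr_lt1.
have s0 : 0 < s by rewrite exprn_gt0.
have u0 : 0 < 1 + s by rewrite addr_gt0.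
by rewrite /net_const; do ![apply: addr_gt0];
  rewrite ?(ltr0n, divr_gt0, mulr_gt0, exprn_gt0).
Qed.

(** A and B are the consensus errors of x and v, d the size of the local displacement, e the
    triggering error, X the change of x; primes mark the next iteration. The gains from contracting
    A^2 and B^2 pay for the cross terms A d and B d and for the X^2 that enters B'. *)
Lemma potential_descent_scalar (F F' A A' B B' d e X Q : R) :
  0 <= A -> 0 <= A' -> 0 <= B' -> 0 <= d -> 0 <= e -> 0 <= X ->
  A' <= r * (A + d) + 2 * e ->
  X <= A' + A + d ->
  B' <= r * (B + L * X) + 2 * e ->
  F' <= F - N^-1 * (Q - L * d ^+ 2 - B * d - L * A * d) ->
  F' + A' ^+ 2 + potential_weight * B' ^+ 2
  <= F + A ^+ 2 + potential_weight * B ^+ 2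
     - N^-1 * (Q - net_const * d ^+ 2)
     - (1 - s) * (3 - 2 * s) / 8 * A ^+ 2 - v_rate * B ^+ 2
     + (8 * ((1 + s) / (1 - s)) + (1 - s) * (1 + 3 * s * L ^+ 2) / (24 * L ^+ 2))
       * e ^+ 2.
Proof.
move=> A0 A'0 B'0 d0 e0 X0 hA hX hB hF.
have s1 := sqr_lt1; have s0 : 0 < s by rewrite exprn_gt0.
have t0 : 0 < 1 - s by rewrite subr_gt0.
have u0 : 0 < 1 + s by rewrite addr_gt0.
have hA2 := contraction_sqr A'0 s1 hA.
have hB2 := contraction_sqr B'0 s1 hB.
have X2 : X ^+ 2 <= 12 * (A ^+ 2 + d ^+ 2 + e ^+ 2).
  have hX2 : X <= 2 * A + 2 * d + 2 * e.
    have : r * (A + d) <= A + d by rewrite ler_piMl ?addr_ge0 // ltW.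
    by lra.
  have h : X ^+ 2 <= (2 * A + 2 * d + 2 * e) ^+ 2.
    by rewrite lerXn2r ?nnegrE ?(le_trans X0 hX2).
  have := sqr_ge0 (A - d); have := sqr_ge0 (A - e); have := sqr_ge0 (d - e).
  by lra.
have w0 : 0 < potential_weight.
  by rewrite ?(ltr0n, divr_gt0, mulr_gt0, exprn_gt0).
have v0 : 0 < v_rate by rewrite ?(ltr0n, divr_gt0, mulr_gt0, exprn_gt0).
(* Contraction gains 2 [v_rate] B^2 and (1 - s) / 2 A^2; the cross terms spend one [v_rate] B^2 and
   (1 - s) / 8 A^2 of it. *)
have y1 := young_weighted B (d / N) v0.
have y2 := young_weighted A (L * d / N) (divr_gt0 t0 (ltr0n R 8)).
have hwB := ler_wpM2l (ltW w0) hB2.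
have k0 : 0 <= s * (1 - s) / 144 by rewrite divr_ge0 ?mulr_ge0 ?ltW.
have hwX := ler_wpM2l k0 X2.
(* The weight is chosen to cancel L^2 here, leaving a small multiple of X^2 that the gain in A^2 can
   absorb. *)
have E1 : potential_weight * (2 * s * ((1 + s) / (1 - s)) * (L * X) ^+ 2) =
    s * (1 - s) / 144 * X ^+ 2.
  rewrite /potential_weight; field; rewrite ?gt_eqF //.
have E2 : potential_weight * (8 * ((1 + s) / (1 - s)) * e ^+ 2) =
    (1 - s) / (36 * L ^+ 2) * e ^+ 2.
  rewrite /potential_weight; field; rewrite ?gt_eqF //.
have E3 : potential_weight * ((1 + s) / 2 * B ^+ 2) =
    potential_weight * B ^+ 2 - 2 * (v_rate * B ^+ 2).
  rewrite /potential_weight /v_rate; field; rewrite ?gt_eqF //.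
(* The terms of [net_const] in order: smoothness of F, the Young remainders of A d and B d, the
   contraction of A, and the d^2 part of X^2. *)
have E4 : N^-1 * (net_const * d ^+ 2) =
    N^-1 * (L * d ^+ 2) + (L * d / N) ^+ 2 / (4 * ((1 - s) / 8))
    + (d / N) ^+ 2 / (4 * v_rate)
    + 2 * s * ((1 + s) / (1 - s)) * d ^+ 2 + 7 / 24 * s * (1 - s) * d ^+ 2.
  rewrite /net_const /v_rate; field; rewrite ?gt_eqF //.
have E5 : (1 - s) * (1 + 3 * s * L ^+ 2) / (24 * L ^+ 2) * e ^+ 2 =
    3 / 2 * ((1 - s) / (36 * L ^+ 2) * e ^+ 2) + s * (1 - s) / 8 * e ^+ 2.
  by field; rewrite ?gt_eqF.
have E6 : N^-1 * (Q - L * d ^+ 2 - B * d - L * A * d) =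
   N^-1 * Q - N^-1 * (L * d ^+ 2) - B * (d / N) - A * (L * d / N).
  by field; rewrite ?gt_eqF.
rewrite !mulrDr E1 E2 E3 in hwB.
rewrite mulrBr E4 (mulrDl (8 * _)) E5; rewrite E6 in hF.
have p1 : 0 <= (1 - s) / (36 * L ^+ 2) * e ^+ 2.
  by rewrite mulr_ge0 ?sqr_ge0 // divr_ge0 ?mulr_ge0 ?sqr_ge0 // ltW.
have p2 x : 0 <= s * (1 - s) * x ^+ 2.
  by rewrite mulr_ge0 ?sqr_ge0 // mulr_ge0 // ltW.
have := p2 A; have := p2 d; have := p2 e.
lra.
Qed.

End ScalarInequalities.

(** * Descent of the potential *)

Section Descent.
Context {R : realType} {n p : nat} (D : setup R n p).
Context (HD : standing_assumptions D).
Context (Halpha :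
  alpha D <= Num.min (Num.min (1 / (2 * Gamma D * Lip D))
                              (psi D / (Lip D * Psi D ^+ 2)))
                     (psi D / (16 * Gamma D ^+ 2 * Cnet D))).

Local Notation L := (Lip D).
Local Notation a := (alpha D).
Local Notation N := (n%:R : R).
Local Notation rho := (sigma D ^+ Kc D).
Local Notation g i := (gradient (fobj D i)).

Let L0 : 0 < L := Lip_gt0 HD.
Let a0 : 0 < a := alpha_gt0 HD.
Let N0 : 0 < N. Proof. by rewrite ltr0n (node_gt0 HD). Qed.
Let Psi0 : 0 < Psi D := Psi_gt0 D.
Let psi0 : 0 < psi D := psi_gt0 HD.
Let Gam0 : 0 < Gamma D. Proof. exact: Gamma_gt0. Qed.

Lemma rho_gt0 : 0 < rho.
Proof. by rewrite exprn_gt0 ?(sigma_gt0 HD). Qed.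

Lemma rho_lt1 : rho < 1.
Proof.
rewrite exprn_ilt1 ?(sigma_lt1 HD) ?ltW ?(sigma_gt0 HD) //.
by rewrite -lt0n (Kc_ge1 HD).
Qed.

Lemma sigma2E : sigma D ^+ (2 * Kc D) = rho ^+ 2.
Proof. by rewrite mulnC exprM. Qed.

Lemma CnetE : Cnet D = net_const rho N L.
Proof. by rewrite /Cnet sigma2E. Qed.

Lemma Cnet_gt0 : 0 < Cnet D.
Proof. by rewrite CnetE net_const_gt0 ?rho_gt0 ?rho_lt1. Qed.

Lemma alpha_Gamma : 2 * Gamma D * L * a <= 1.
Proof.
move: Halpha; rewrite !le_min => /andP[/andP[h _] _].
by move: h; rewrite ler_pdivlMr ?mulr_gt0 // [a * _]mulrC.
Qed.

Lemma alpha_Psi : a * L * Psi D ^+ 2 <= psi D.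
Proof.
have := Halpha; rewrite 2!le_min => /andP[/andP[_ h] _].
have LP0 : 0 < L * Psi D ^+ 2 by apply: mulr_gt0; rewrite ?exprn_gt0.
by move: h; rewrite ler_pdivlMr // mulrA.
Qed.

Lemma alpha_Cnet : 16 * (a * Gamma D ^+ 2 * Cnet D) <= psi D.
Proof.
have := Halpha; rewrite le_min => /andP[_].
rewrite ler_pdivlMr ?mulr_gt0 ?exprn_gt0 ?Cnet_gt0 //; lra.
Qed.

(** Of psi / 4, the stepsize bounds let the [Psi] term take at most psi / 8 and the [Cnet] term at
    most psi / 16. *)
Lemma Cf_ge : a * psi D / (16 * N) <= Cf D.
Proof.
rewrite /Cf [X in X <= _](_ : _ = a / N * (psi D / 16)); last first.
  by field; rewrite gt_eqF.
apply: ler_wpM2l; first by rewrite divr_ge0 ?ltW.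
have := alpha_Psi; have := alpha_Cnet; lra.
Qed.

Lemma Cf_gt0 : 0 < Cf D.
Proof. by apply: lt_le_trans Cf_ge; rewrite divr_gt0 ?mulr_gt0. Qed.

Lemma Cloc_gt0 : 0 < Cloc D.
Proof.
rewrite /Cloc divr_gt0 ?(Cloc_den_gt0 HD alpha_Psi) //.
rewrite mulr_gt0 ?exprn_gt0 // addr_gt0 //.
by rewrite !mulr_gt0 ?exprn_gt0 ?divr_gt0.
Qed.

Lemma adadqn_between t i : between (psi D) (Psi D) (st_H (adadqn D t) i).
Proof.
case: t => [|t] /=.
  exact: between_weaken (psi_le1 D) (Psi_ge1 D) between1.
by apply: MBFGS_between => //; exact: grad_lipschitz.
Qed.

(** The net local move before communication, signed so that x minus it is what gets communicated. *)
Definition displacement t i : 'cV[R]_p :=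
  xit D t i - local_out D (adadqn D t) i.

Lemma displacement_le t i :
  enorm (displacement t i) <= Gamma D * a * enorm (vit D t i).
Proof.
exact (local_out_dist HD alpha_Gamma (adadqn_between t i)).
Qed.

Lemma xitS t : xit D t.+1 = ETC D t (fun i => xit D t i - displacement t i).
Proof.
rewrite {1}/xit /=; congr ETC; apply/funext => i.
by rewrite /displacement subKr.
Qed.

(** Invariance of the tracking error cancels all intermediate gradients, leaving the plain gradient
    tracking update. *)
Lemma vitS t : vit D t.+1 =
  ETC D t (fun i => vit D t i + (g i (xit D t.+1 i) - g i (xit D t i))).
Proof.
rewrite {1}/vit /=; congr ETC; apply/funext => i.
have [h _] := local_iterP HD (adadqn_between t i) (Kg D).-1.
rewrite addrAC h -/(vit D t i) -/(xit D t i) addrAC -addrA.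
by [].
Qed.

Lemma mean_vit t : mean (vit D t) = mean (fun i => g i (xit D t i)).
Proof.
elim: t => [//|t IH]; rewrite vitS /ETC etc_mean // meanD IH meanB.
by rewrite subrKC.
Qed.

Lemma mean_xitS t : mean (xit D t.+1) = mean (xit D t) - mean (displacement t).
Proof. by rewrite xitS /ETC etc_mean // meanB. Qed.

Lemma F_smooth_le x y :
  F D y <= F D x + dot (mean (fun i => g i x)) (y - x)
           + L / 2 * dot (y - x) (y - x).
Proof.
have h i : fobj D i y <= fobj D i x + dot (g i x) (y - x)
           + L / 2 * dot (y - x) (y - x).
  apply: smooth_le => [z|]; first exact: (fobj_C1 HD i).1.
  exact: grad_lipschitz.
have : \sum_i fobj D i y <= \sum_i (fobj D i x + dot (g i x) (y - x)
           + L / 2 * dot (y - x) (y - x)) by apply: ler_sum.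
rewrite !big_split /= sumr_const card_ord -[_ *+ n]mulr_natl => hs.
rewrite /F /mean dotZl dot_suml.
have := ler_wpM2l (_ : 0 <= N^-1) hs; rewrite invr_ge0 ltW // => /(_ isT).
by rewrite !mulrDr [N^-1 * (N * _)]mulrA mulVf ?gt_eqF // mul1r.
Qed.

Local Notation A t := (consensus_err (xit D t)).
Local Notation B t := (consensus_err (vit D t)).
Local Notation V t := (enorm (stack (vit D t))).
Local Notation d t := (enorm (stack (displacement t))).
Local Notation e t := (Num.sqrt N * eta_seq D t * etc_sum D).
Local Notation X t := (enorm (stack (fun i => xit D t.+1 i - xit D t i))).

Lemma d_le t : d t <= Gamma D * a * V t.
Proof.
apply: enorm_stack_scale => [|i]; first by rewrite mulr_ge0 ?ltW.
exact: displacement_le.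
Qed.

Lemma A_le t : A t.+1 <= rho * (A t + d t) + 2 * e t.
Proof.
rewrite {1}xitS (le_trans (etc_consensus HD _ _ _)) // -mulrA lerD2r.
rewrite ler_wpM2l ?(ltW rho_gt0) // (le_trans (consensus_errB _ _)) //.
by rewrite lerD2l consensus_err_le ?(node_gt0 HD).
Qed.

(** The change of x splits into the deviations from the mean at both times and the displacement of
    the mean. *)
Lemma X_le t : X t <= A t.+1 + A t + d t.
Proof.
rewrite (_ : (fun i => _) = (fun i => xit D t.+1 i - mean (xit D t.+1)
   - (xit D t i - mean (xit D t)) - mean (displacement t))); last first.
  apply/funext => i; rewrite mean_xitS; move: (mean _) (mean _) => m1 m2.
  by apply/colP => k; rewrite !mxE; ring.
rewrite stackB; apply: (le_trans (enormB _ _)); apply: lerD.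
  by rewrite stackB !consensus_errE; exact: enormB.
exact: enorm_stack_mean (node_gt0 HD).
Qed.

Lemma grad_diff_le (y z : 'I_n -> 'cV[R]_p) :
  enorm (stack (fun i => g i (y i) - g i (z i)))
  <= L * enorm (stack (fun i => y i - z i)).
Proof.
by apply: enorm_stack_scale => [|i]; [exact: ltW|exact: grad_lipschitz].
Qed.

Lemma B_le t : B t.+1 <= rho * (B t + L * X t) + 2 * e t.
Proof.
rewrite {1}vitS (le_trans (etc_consensus HD _ _ _)) // -mulrA lerD2r.
rewrite ler_wpM2l ?(ltW rho_gt0) // (le_trans (consensus_errD _ _)) //.
rewrite lerD2l (le_trans (consensus_err_le _ (node_gt0 HD))) //.
exact: grad_diff_le.
Qed.

Lemma dot_displacement t :
  a * (psi D / 4 - a * L * Psi D ^+ 2 / 8) * V t ^+ 2 - L / 2 * d t ^+ 2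
  <= \sum_i dot (vit D t i) (displacement t i).
Proof.
rewrite !sqr_enorm !dot_stack !mulr_sumr -sumrB; apply: ler_sum => i _.
rewrite -!sqr_enorm.
exact (local_out_descent HD alpha_Psi (adadqn_between t i)).
Qed.

(** Local descent controls the sum of v_i.d_i, while smoothness of F involves n G.M. They differ by
    the deviation of v paired with d, at most B d, and by the gradients being taken at x_i rather
    than at the mean, at most L A d. *)
Lemma F_mean_le t : F D (mean (xit D t.+1)) <= F D (mean (xit D t))
  - N^-1 * (a * (psi D / 4 - a * L * Psi D ^+ 2 / 8) * V t ^+ 2
            - L * d t ^+ 2 - B t * d t - L * A t * d t).
Proof.
set m := mean (xit D t); set M := mean (displacement t).
set G := mean (fun i => g i m).
have := F_smooth_le m (mean (xit D t.+1)).
have -> : mean (xit D t.+1) - m = - M by rewrite mean_xitS addrAC subrr add0r.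
rewrite dotNl !dotNr opprK -/G => hF.
apply: (le_trans hF).
have hM : N * dot M M <= d t ^+ 2.
  have := enorm_stack_mean (displacement t) (node_gt0 HD).
  move=> /(enorm_leP _ (enorm_ge0 _)).1.
  by rewrite dot_stack sumr_const card_ord mulr_natl.
have hG : N * dot (mean (vit D t) - G) M <= L * A t * d t.
  have -> : N * dot (mean (vit D t) - G) M =
     dot (stack (fun _ : 'I_n => mean (vit D t) - G)) (stack (fun=> M)).
    by rewrite dot_stack sumr_const card_ord mulr_natl.
  apply: (le_trans (dot_le_enorm _ _)).
  apply: ler_pM; rewrite ?enorm_ge0 ?enorm_stack_mean ?(node_gt0 HD) //.
  rewrite mean_vit -meanB (le_trans (enorm_stack_mean _ (node_gt0 HD))) //.
  by rewrite consensus_errE grad_diff_le.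
have hB : \sum_i dot (vit D t i - mean (vit D t)) (displacement t i) <= B t * d t.
  by rewrite consensus_errE -dot_stack dot_le_enorm.
have hV := dot_displacement t.
have E : N * dot G M = \sum_i dot (vit D t i) (displacement t i)
   - \sum_i dot (vit D t i - mean (vit D t)) (displacement t i)
   - N * dot (mean (vit D t) - G) M.
  rewrite -sumrB; under eq_bigr do rewrite -dotBl subKr.
  rewrite -dot_sumr sum_mean ?(node_gt0 HD) // dotZr -/M dotBl; ring.
rewrite -(ler_pM2l N0).
have -> : N * (F D m - N^-1 * (a * (psi D / 4 - a * L * Psi D ^+ 2 / 8) * V t ^+ 2
            - L * d t ^+ 2 - B t * d t - L * A t * d t)) =
   N * F D m - (a * (psi D / 4 - a * L * Psi D ^+ 2 / 8) * V t ^+ 2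
            - L * d t ^+ 2 - B t * d t - L * A t * d t).
  by field; rewrite gt_eqF.
have := ler_wpM2l (divr_ge0 (ltW L0) (ler0n R 2)) hM.
lra.
Qed.

Lemma potential_descent t :
  potential D (xit D t.+1) (vit D t.+1)
  <= potential D (xit D t) (vit D t) - Cf D * V t ^+ 2
     - Cx D * A t ^+ 2 - Cv D * B t ^+ 2
     + (theta1 D + theta2 D) * eta_seq D t ^+ 2.
Proof.
have e0 : 0 <= e t.
  rewrite !mulr_ge0 ?(eta_ge0 HD) ?sqrtr_ge0 // sumr_ge0 // => k _.
  by rewrite mulr_ge0 ?(tau_ge0 HD) ?exprn_ge0 // ltW ?(sigma_gt0 HD).
have := potential_descent_scalar rho_gt0 rho_lt1 N0 L0
  (consensus_err_ge0 _) (consensus_err_ge0 _) (consensus_err_ge0 _)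
  (enorm_ge0 _) e0 (enorm_ge0 _) (A_le t) (X_le t) (B_le t) (F_mean_le t).
rewrite /potential /Cx /Cv /theta1 /theta2 sigma2E.
rewrite -/(potential_weight rho L) -/(v_rate rho L).
have e2 : e t ^+ 2 = N * eta_seq D t ^+ 2 * etc_sum D ^+ 2.
  by rewrite !exprMn sqr_sqrtr // ltW.
have hd : d t ^+ 2 <= (Gamma D * a * V t) ^+ 2.
  by rewrite lerXn2r ?nnegrE ?enorm_ge0 ?d_le // (le_trans _ (d_le t)) ?enorm_ge0.
have hN : N^-1 * (net_const rho N L * d t ^+ 2) <=
          N^-1 * (net_const rho N L * (Gamma D * a * V t) ^+ 2).
  rewrite ler_wpM2l ?invr_ge0 ?(ltW N0) // ler_wpM2l // -CnetE.
  exact/ltW/Cnet_gt0.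
have -> : Cf D * V t ^+ 2 =
   N^-1 * (a * (psi D / 4 - a * L * Psi D ^+ 2 / 8) * V t ^+ 2)
   - N^-1 * (net_const rho N L * (Gamma D * a * V t) ^+ 2).
  by rewrite /Cf -CnetE; field; rewrite gt_eqF.
rewrite e2; move: hN; lra.
Qed.

End Descent.

(** * Counting gradient evaluations *)

Lemma quotient_le (R : realType) (N al cl di ps f e : R) :
  0 < N -> 0 < al -> 0 < cl -> 0 <= di -> 0 < ps -> 0 < f -> 0 < e ->
  al * ps / (16 * N) <= f ->
  cl * al ^+ 2 * di / (f * e) <= 16 * cl * di / ps * (N * al / e).
Proof.
move=> N0 a0 c0 d0 p0 f0 e0 hf; rewrite ler_pdivrMr ?mulr_gt0 //.
have k0 : 0 <= 16 * cl * di / ps * (N * al).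
  by rewrite !mulr_ge0 ?invr_ge0 // ltW.
have := ler_wpM2l k0 hf.
have -> : 16 * cl * di / ps * (N * al) * (al * ps / (16 * N)) = cl * al ^+ 2 * di.
  by field; rewrite !gt_eqF.
have -> // : 16 * cl * di / ps * (N * al / e) * (f * e) =
          16 * cl * di / ps * (N * al) * f.
by field; rewrite !gt_eqF.
Qed.

Section Complexity.
Context {R : realType} {n p : nat} (D : setup R n p).
Context (HD : standing_assumptions D).
Context (Halpha :
  alpha D <= Num.min (Num.min (1 / (2 * Gamma D * Lip D))
                              (psi D / (Lip D * Psi D ^+ 2)))
                     (psi D / (16 * Gamma D ^+ 2 * Cnet D))).

Local Notation N := (n%:R : R).
Local Notation rho := (sigma D ^+ Kc D).

Let s0 : 0 < 1 - rho ^+ 2.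
Proof. by rewrite subr_gt0 sqr_lt1 ?(rho_gt0 HD) ?(rho_lt1 HD). Qed.

Lemma Chat_gt0 : 0 < Chat D.
Proof.
rewrite /Chat !lt_min (Cf_gt0 HD Halpha) /Cx /Cv sigma2E /=.
have L0 := Lip_gt0 HD; have r0 : 0 < 1 + rho ^+ 2.
  by rewrite addr_gt0 // exprn_gt0 ?(rho_gt0 HD).
rewrite !divr_gt0 ?mulr_gt0 ?exprn_gt0 ?ltr0n //.
by move: s0; lra.
Qed.

Lemma theta_ge0 : 0 <= theta1 D + theta2 D.
Proof.
have L0 := ltW (Lip_gt0 HD); have r0 := sqr_ge0 rho; have u0 := ltW s0.
have r1 : 0 <= 1 + rho ^+ 2 by rewrite addr_ge0.
have r3 : 0 <= 1 + 3 * rho ^+ 2 * Lip D ^+ 2.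
  by rewrite addr_ge0 ?(sqr_ge0, mulr_ge0).
rewrite /theta1 /theta2 sigma2E.
by apply: addr_ge0; rewrite !(sqr_ge0, mulr_ge0, invr_ge0, ler0n).
Qed.

Lemma descent_sum T :
  Finf D + \sum_(t < T) (Cf D * enorm (stack (vit D t)) ^+ 2
     + Cx D * consensus_err (xit D t) ^+ 2 + Cv D * consensus_err (vit D t) ^+ 2)
  <= potential D (xit D 0) (vit D 0) + Theta D T.
Proof.
have hF : Finf D <= potential D (xit D T) (vit D T).
  have h : Finf D <= F D (mean (xit D T)).
    by apply: ge_inf; [exact: F_bounded_below|exists (mean (xit D T))].
  have w0 : 0 <= (1 - rho ^+ 2) ^+ 2 / (288 * (1 + rho ^+ 2) * Lip D ^+ 2).
    by rewrite !(sqr_ge0, ler0n, ler01, invr_ge0, mulr_ge0, addr_ge0).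
  rewrite /potential sigma2E; apply: (le_trans h).
  have := sqr_ge0 (consensus_err (xit D T)).
  have := mulr_ge0 w0 (sqr_ge0 (consensus_err (vit D T))); lra.
suff h : potential D (xit D T) (vit D T)
   + \sum_(t < T) (Cf D * enorm (stack (vit D t)) ^+ 2
     + Cx D * consensus_err (xit D t) ^+ 2 + Cv D * consensus_err (vit D t) ^+ 2)
  <= potential D (xit D 0) (vit D 0) + Theta D T.
  by apply: le_trans h; rewrite lerD2r.
rewrite /Theta; elim: T {hF} => [|T IH]; first by rewrite !big_ord0 mulr0.
rewrite !big_ord_recr /= mulrDr.
have := potential_descent HD Halpha T; lra.
Qed.

Lemma residual_sum T :
  Chat D * \sum_(t < T) residual D t <= DT D T.
Proof.
have := descent_sum T; rewrite /DT.
suff : Chat D * \sum_(t < T) residual D t <=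
  \sum_(t < T) (Cf D * enorm (stack (vit D t)) ^+ 2
     + Cx D * consensus_err (xit D t) ^+ 2 + Cv D * consensus_err (vit D t) ^+ 2).
  by lra.
rewrite mulr_sumr; apply: ler_sum => t _; rewrite /residual.
have hf : Chat D <= Cf D by rewrite /Chat !ge_min lexx.
have hx : Chat D <= Cx D by rewrite /Chat !ge_min lexx orbT.
have hv : Chat D <= Cv D by rewrite /Chat !ge_min lexx orbT.
have := ler_wpM2r (sqr_ge0 (enorm (stack (vit D t)))) hf.
have := ler_wpM2r (sqr_ge0 (consensus_err (xit D t))) hx.
have := ler_wpM2r (sqr_ge0 (consensus_err (vit D t))) hv.
lra.
Qed.

Lemma enorm_vit_sum T :
  Cf D * \sum_(t < T) enorm (stack (vit D t)) ^+ 2 <= DT D T.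
Proof.
have := descent_sum T; rewrite /DT.
suff : Cf D * \sum_(t < T) enorm (stack (vit D t)) ^+ 2 <=
  \sum_(t < T) (Cf D * enorm (stack (vit D t)) ^+ 2
     + Cx D * consensus_err (xit D t) ^+ 2 + Cv D * consensus_err (vit D t) ^+ 2).
  by lra.
rewrite mulr_sumr; apply: ler_sum => t _.
have := Chat_gt0; rewrite /Chat !lt_min => /andP[/andP[_ hx] hv].
have := mulr_ge0 (ltW hx) (sqr_ge0 (consensus_err (xit D t))).
have := mulr_ge0 (ltW hv) (sqr_ge0 (consensus_err (vit D t))).
lra.
Qed.

Lemma Gada_le T : (Gada D T)%:R <= N + N * T%:R
  + Cloc D * alpha D ^+ 2 * DT D T / (Cf D * epst D ^+ 2).
Proof.
have e0 : 0 < epst D ^+ 2 by rewrite exprn_gt0 ?(epst_gt0 HD).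
have f0 := Cf_gt0 HD Halpha.
have l0 := Cloc_gt0 HD Halpha.
rewrite /Gada !natrD natrM lerD2l ler_pdivlMr ?(mulr_gt0 f0 e0) // mulrCA.
have h : (\sum_(t < T) \sum_(i < n) nlocal D t i)%N%:R * epst D ^+ 2
   <= alpha D ^+ 2 * Cloc D * \sum_(t < T) enorm (stack (vit D t)) ^+ 2.
  rewrite natr_sum mulr_suml mulr_sumr; apply: ler_sum => t _.
  rewrite natr_sum mulr_suml sqr_enorm dot_stack mulr_sumr; apply: ler_sum => i _.
  rewrite -sqr_enorm.
  exact (nlocal_le HD (alpha_Gamma HD Halpha) (alpha_Psi HD Halpha)
           (adadqn_between HD t i)).
have h1 := ler_wpM2l (ltW f0) h.
have c0 : 0 <= alpha D ^+ 2 * Cloc D by rewrite mulr_ge0 ?sqr_ge0 ?ltW.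
have h2 := ler_wpM2l c0 (enorm_vit_sum T).
lra.
Qed.

Context (eta_cvg : cvgn (series (fun t => eta_seq D t ^+ 2))).

Lemma DT_le T : DT D T <= Dinf D.
Proof.
rewrite /DT /Dinf lerD2l /Theta ler_wpM2l ?theta_ge0 //.
have -> : \sum_(t < T) eta_seq D t ^+ 2 = series (fun t => eta_seq D t ^+ 2) T.
  by rewrite /series /= big_mkord.
apply: nondecreasing_cvgn_le => //.
by apply: nondecreasing_series => k _ _; exact: sqr_ge0.
Qed.

Lemma Dinf_ge0 : 0 <= Dinf D.
Proof.
by apply: le_trans (DT_le 0); have := residual_sum 0; rewrite big_ord0 mulr0.
Qed.

Lemma first_hit_exists delta : 0 < delta -> exists2 t, first_hit D delta t &
  t%:R <= (Num.ceil (Dinf D / (Chat D * delta)))%:~R :> R.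
Proof.
move=> d0; have c0 := Chat_gt0.
set q := Dinf D / (Chat D * delta).
have q0 : 0 <= q by rewrite divr_ge0 ?Dinf_ge0 ?mulr_ge0 ?ltW.
have ceil0 : 0 <= Num.ceil q by rewrite ceil_ge0 (lt_le_trans _ q0) ?ltrN10.
set T := `|Num.ceil q|%N.
have TE : T%:R = (Num.ceil q)%:~R :> R by rewrite natr_absz ger0_norm.
have hex : exists t, (t <= T)%N && (residual D t <= delta).
  apply: contrapT => hn.
  have hlt t : (t < T.+1)%N -> delta < residual D t.
    move=> tT; rewrite ltNge; apply/negP => h; apply: hn; exists t.
    by rewrite h andbT -ltnS.
  have h1 : delta * T.+1%:R <= \sum_(t < T.+1) residual D t.
    rewrite mulr_natr -[in leLHS](card_ord T.+1) -sumr_const.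
    by apply: ler_sum => t _; exact/ltW/hlt.
  have h2 := le_trans (residual_sum T.+1) (DT_le T.+1).
  have h3 := ler_wpM2l (ltW c0) h1.
  have h4 : Dinf D <= T%:R * (Chat D * delta).
    by rewrite -ler_pdivrMr ?mulr_gt0 // TE ceil_ge.
  have h5 : 0 < Chat D * delta by rewrite mulr_gt0.
  by rewrite -natr1 in h3; lra.
case: (ex_minnP hex) => t /andP[tT tres] tmin; exists t.
  split=> // k kt; rewrite ltNge; apply/negP => h.
  have := tmin k; rewrite h andbT (leq_trans (ltnW kt) tT) => /(_ isT).
  by rewrite leqNgt kt.
by rewrite -TE ler_nat.
Qed.

Lemma first_hit_inj delta t t' :
  first_hit D delta t -> first_hit D delta t' -> t = t'.
Proof.
move=> [ht mt] [ht' mt']; case: (ltngtP t t') => // h.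
  by move: (lt_le_trans (mt' t h) ht); rewrite ltxx.
by move: (lt_le_trans (mt t' h) ht'); rewrite ltxx.
Qed.

Lemma Gada_first_hit_le delta t : 0 < delta -> first_hit D delta t ->
  (Gada D t)%:R <= N + N * (Num.ceil (Dinf D / (Chat D * delta)))%:~R
    + Cloc D * alpha D ^+ 2 * Dinf D / (Cf D * epst D ^+ 2).
Proof.
move=> d0 ht; have [t' ht' ceilE] := first_hit_exists d0.
rewrite -(first_hit_inj ht ht') in ceilE.
apply: (le_trans (Gada_le t)); apply: lerD.
  by rewrite lerD2l ler_wpM2l.
have f0 := Cf_gt0 HD Halpha; have l0 := Cloc_gt0 HD Halpha.
apply: ler_wpM2r; first by rewrite invr_ge0 (mulr_ge0 (ltW f0)) ?sqr_ge0.
by apply: ler_wpM2l; [rewrite (mulr_ge0 (ltW l0)) ?sqr_ge0|exact: DT_le].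
Qed.

Lemma Gada_first_hit_O delta t : 0 < delta -> delta <= 1 -> first_hit D delta t ->
  (Gada D t)%:R
  <= (2 + Dinf D / Chat D + 16 * Cloc D * Dinf D / psi D)
     * (N / delta + N * alpha D / epst D ^+ 2).
Proof.
move=> d0 d1 ht; apply: (le_trans (Gada_first_hit_le d0 ht)).
have c0 := Chat_gt0; have D0 := Dinf_ge0; have f0 := Cf_gt0 HD Halpha.
have l0 := Cloc_gt0 HD Halpha; have p0 := psi_gt0 HD.
have a0 := alpha_gt0 HD.
have N0 : 0 < N by rewrite ltr0n (node_gt0 HD).
have e0 : 0 < epst D ^+ 2 by rewrite exprn_gt0 ?(epst_gt0 HD).
set q := Dinf D / (Chat D * delta).
have hc : (Num.ceil q)%:~R <= q + 1.
  by have := ceilB1_lt q; rewrite intrD /=; lra.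
have i1 : 1 <= delta^-1 by rewrite invf_ge1.
have h1 : N + N * (Num.ceil q)%:~R <= (2 + Dinf D / Chat D) * (N / delta).
  have := ler_wpM2l (ltW N0) hc; have := ler_wpM2l (ltW N0) i1.
  have -> : q = Dinf D / Chat D * delta^-1 by rewrite /q invfM mulrA.
  lra.
have h2 : Cloc D * alpha D ^+ 2 * Dinf D / (Cf D * epst D ^+ 2)
    <= 16 * Cloc D * Dinf D / psi D * (N * alpha D / epst D ^+ 2).
  exact: quotient_le N0 a0 l0 D0 p0 f0 e0 (Cf_ge HD Halpha).
have w1 : 0 <= (2 + Dinf D / Chat D) * (N * alpha D / epst D ^+ 2).
  apply: mulr_ge0; first by rewrite (addr_ge0 (ler0n R 2)) // (divr_ge0 D0 (ltW c0)).
  exact: ltW (divr_gt0 (mulr_gt0 N0 a0) e0).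
have w2 : 0 <= 16 * Cloc D * Dinf D / psi D * (N / delta).
  apply: mulr_ge0; last exact: ltW (divr_gt0 N0 d0).
  by rewrite (divr_ge0 (mulr_ge0 (ltW (mulr_gt0 (ltr0n R 16) l0)) D0) (ltW p0)).
have key (x y z w : R) : 0 <= x * w -> 0 <= y * z ->
    x * z + y * w <= (x + y) * (z + w) by move=> *; lra.
exact: le_trans (lerD h1 h2) (key _ _ _ _ w1 w2).
Qed.

End Complexity.

(* K gives the constant hidden in the O: it is chosen before the instance and
   sees it only through Dinf, Chat, Cloc and psi.  As n / delta tends to 0 for
   large delta, the O is understood for delta in (0, 1]. *)
Theorem corollary4p7 (R : realType) :
  exists K : R -> R -> R -> R -> R,
  forall (n p : nat) (D : setup R n p),
  standing_assumptions D ->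
  cvgn (series (fun t => eta_seq D t ^+ 2)) ->
  alpha D <= Num.min (Num.min (1 / (2 * Gamma D * Lip D))
                              (psi D / (Lip D * Psi D ^+ 2)))
                     (psi D / (16 * Gamma D ^+ 2 * Cnet D)) ->
  [/\ forall T : nat, (1 <= T)%N ->
        (Gada D T)%:R <= n%:R + n%:R * T%:R
          + Cloc D * alpha D ^+ 2 * DT D T / (Cf D * epst D ^+ 2),
      forall delta : R, 0 < delta -> exists2 t : nat, first_hit D delta t &
        (Gada D t)%:R <= n%:R + n%:R * (Num.ceil (Dinf D / (Chat D * delta)))%:~R
          + Cloc D * alpha D ^+ 2 * Dinf D / (Cf D * epst D ^+ 2),
      alpha D * psi D / (16 * n%:R) <= Cf D
    & forall (delta : R) (t : nat), 0 < delta -> delta <= 1 ->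
        first_hit D delta t ->
        (Gada D t)%:R <= K (Dinf D) (Chat D) (Cloc D) (psi D)
          * (n%:R / delta + n%:R * alpha D / epst D ^+ 2)].
Proof.
exists (fun Di Ch Cl ps => 2 + Di / Ch + 16 * Cl * Di / ps).
move=> n p D HD eta_cvg Halpha; split.
- by move=> T _; exact: Gada_le.
- move=> delta d0; have [t ht _] := first_hit_exists HD Halpha eta_cvg d0.
  by exists t => //; exact: Gada_first_hit_le.
- exact: Cf_ge.
- by move=> delta t d0 d1 ht; exact: Gada_first_hit_O.
Qed.
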